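(* Fix an integer $d\ge 2$. There is a sequence $(\varepsilon_n)_{n\ge 1}$ with $\varepsilon_n = o(1)$ such that the following holds: for $t = (1+\varepsilon_n)\, n\log n/2$ and $b = (1+\varepsilon_n)\, dn/2$, there exists a $(t,b)$-strategy of Builder such that $G_t$ is $d$-connected asymptotically almost surely (i.e. with probability tending to $1$ as $n\to\infty$).
   Context: Model: the edges of the complete graph $K_n$ are ordered uniformly at random and revealed one per round to a player called Builder, who starts with the empty graph on $V(K_n)$. At each round Builder must decide (based only on the sequence of edges proposed so far) whether to accept the currently proposed edge. For $s\ge 0$, $G_s$ denotes the graph of all edges accepted by Builder during the first $s$ rounds. A strategy of Builder is a (possibly random) function which, given $s\le\binom n2$ and an $s$-tuple $(e_1,\dots,e_s)$ of distinct edges of $K_n$, outputs $1$ if Builder accepts $e_s$ at round $s$ (given that $e_1,\dots,e_{s-1}$ were proposed before, in this order) and $0$ otherwise. A $(t,b)$-strategy is a strategy that, for every $s\le t$, decides whether to accept the edge of round $s$ under the constraint $|E(G_s)|\le b$. A graph $G$ is $d$-connected if $|V(G)|\ge d+1$ and removing any set of at most $d-1$ vertices leaves a connected graph. *)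

(* Defs.v *)
From HB Require Import structures.
From mathcomp Require Import all_boot all_order all_algebra.
From mathcomp Require Import all_classical all_reals all_analysis.

Set Implicit Arguments.
Unset Strict Implicit.
Unset Printing Implicit Defensive.

Import Order.TTheory GRing.Theory Num.Theory.
Import numFieldNormedType.Exports.

(* A simple graph on the vertex set [T] is given by its set of edges, which are
   two-element subsets of [T]. *)

Section Graphs.
Variables (T : finType) (E : {set {set T}}).

Definition adj : rel T := fun x y => (x != y) && ([set x; y]%SET \in E).

Definition adj_minus (S : {set T}) : rel T :=
  fun x y => [&& x \notin S, y \notin S & adj x y].

Definition connected_minus (S : {set T}) : bool :=
  [forall x, forall y,
     (x \notin S) && (y \notin S) ==> connect (adj_minus S) x y].

Definition d_connected (d : nat) : bool :=
  (d.+1 <= #|T|)%N && [forall S : {set T}, (#|S| < d)%N ==> connected_minus S].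

End Graphs.

Section Edges.
Variable n : nat.

Record edge := Edge { edge_set :> {set 'I_n}; card_edge_set : #|edge_set| == 2%N }.

HB.instance Definition _ := [isSub for edge_set].
HB.instance Definition _ := [Finite of edge by <:].

Record ordering := Ordering {
  ordering_tuple :> 'C(n, 2).-tuple edge;
  ordering_uniq : uniq ordering_tuple
}.

HB.instance Definition _ := [isSub for ordering_tuple].
HB.instance Definition _ := [Finite of ordering by <:].

(* The s-tuples of distinct edges, for all s <= 'C(n, 2). *)
Record history := History {
  history_bseq :> 'C(n, 2).-bseq edge;
  history_uniq : uniq history_bseq
}.

HB.instance Definition _ := [isSub for history_bseq].
HB.instance Definition _ := [Finite of history by <:].

Lemma card_edge : #|{: edge}| = 'C(n, 2).
Proof.
rewrite card_sub -[n in RHS]card_ord -card_draws.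
by apply: eq_card => e; rewrite !inE.
Qed.

Lemma card_ordering : #|{: ordering}| = 'C(n, 2)`!.
Proof.
rewrite card_sub -ffactnn -[X in (X ^_ _)%N]card_edge -card_uniq_tuples.
by apply: eq_card => p; rewrite !inE all_predT.
Qed.

Lemma proposed_size (p : ordering) (s : nat) : (size (take s p) <= 'C(n, 2))%N.
Proof. by rewrite size_take_min size_tuple geq_minr. Qed.

Definition proposed (p : ordering) (s : nat) : history :=
  @History (Bseq (proposed_size p s)) (take_uniq s (ordering_uniq p)).

End Edges.

(* A deterministic strategy: [f h] is the decision on the last edge of [h]. *)
Notation strategy n := {ffun history n -> bool}.

(* G_s. The edge with index [i : 'I_('C(n, 2))] is proposed at round i + 1. *)
Definition graph_at (n : nat) (f : strategy n) (p : ordering n) (s : nat) :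
    {set {set 'I_n}} :=
  [set edge_set (tnth p i) | i : 'I_('C(n, 2))
                           & (i < s)%N && f (proposed p i.+1)]%SET.

Local Open Scope ring_scope.

(* There are finitely many deterministic strategies on K_n, so a random strategy
   is a probability law on this finite set; it is drawn independently of the edge
   ordering. *)
Record random_strategy (R : realType) (n : nat) := RandomStrategy {
  law :> strategy n -> R;
  law_ge0 : forall f, 0 <= law f;
  law_sum1 : \sum_(f : strategy n) law f = 1
}.

(* [t] and [b] are real; the constraint is on the integer rounds s <= t. *)
Definition tb_strategy (R : realType) (n : nat) (t b : R)
    (B : random_strategy R n) : Prop :=
  forall f : strategy n, 0 < B f ->
  forall (p : ordering n) (s : nat), s%:R <= t -> #|graph_at f p s|%:R <= b.

(* Probability of an event under the product of the law of [B] and the uniform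
   law on the orderings of the edges of K_n. *)
Definition prob (R : realType) (n : nat) (B : random_strategy R n)
    (A : strategy n -> ordering n -> bool) : R :=
  \sum_(f : strategy n)
    B f * (#|[set p : ordering n | A f p]%SET|%:R / #|{: ordering n}|%:R).

(* Main.v *)
(** Fix [delta > 0] and a large constant [A]. The vertices are split into [d] small
    reservoirs of size [u ~ n / A] and the rest. During the first [o(n log n)]
    rounds Builder grows in each reservoir a tree with more than [u / 2] vertices
    and packs almost all other vertices into vertex-disjoint paths ("blobs") of
    length at least [L = 8 A], then lets vertices of the paths choose neighbours in
    distinct other blobs, accepting only edges useful to both ends. In the last
    [(1 + delta / 2) n log n / 2] rounds every vertex completes its list of
    neighbouring blobs ([d - 2] for an inner vertex of a path, [d] otherwise), and
    every blob gets an edge to each of the [d] trees.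

    A set [S] of fewer than [d] vertices misses some tree. A blob missed by [S] is
    attached to it, a vertex with [d] neighbouring blobs has one that [S] misses, and
    an inner vertex of a path either has such a neighbour as well or can walk to an
    end of its path, which [S] then hits only once. The inner vertices cost [d / 2]
    edges each and everything else is [O(n / A)]. Each requirement fails with
    probability controlled by a supermartingale [B ^ phi], where [phi] counts what
    remains to be done: for a single vertex this gives [n ^ - (1 + delta / 4)]. A
    diagonal argument lets [delta] tend to [0]. *)

Require Import Defs.
From mathcomp Require Import all_boot all_order all_algebra perm.
From mathcomp Require Import all_classical all_reals all_analysis.
From mathcomp Require Import ring lra zify.

Set Implicit Arguments.
Unset Strict Implicit.
Unset Printing Implicit Defensive.

Import Order.TTheory GRing.Theory Num.Theory.
Import numFieldNormedType.Exports.
Local Open Scope ring_scope.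

(** With about [n log n / 2] rounds a vertex sees only about [log n] edges, so a union bound over
    vertices leaves no slack: in the last phase almost every edge at a deficient vertex must be
    useful to it. Hence [helps] accepts any end in a new good blob. Such one-sided edges are too
    expensive for all vertices, but while more than [u] of the vertices in good blobs are deficient,
    a constant fraction of all edges serves both ends, so [o(n log n)] rounds of mutual edges leave
    only a small remainder. Contact with the giant trees is the other obstacle. One vertex has fewer
    than [n / A] edges to a given tree, far too few; the [8 A] vertices of a blob together have
    about [2 n] that are still available. Arranging the blob as a path makes it free of charge,
    since the two path edges of an inner vertex count among its [d]. Rejected edges never return, so
    edges already proposed at a vertex are lost to it. Their number is kept below [k = u / 4] by a
    separate degree estimate. Finally the budget must hold for every ordering, not only typically,
    so the process is played with a cap that typically never acts. *)

(** * Random orderings and supermartingales *)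

Section Martingale.
Variables (R : realType) (n : nat).
Local Notation N := 'C(n, 2).
Implicit Types (p : ordering n) (h : seq (edge n)) (e : edge n).

Lemma uniq_swap p (i j : 'I_N) : uniq [tuple tnth p (tperm i j k) | k < N].
Proof.
rewrite map_inj_uniq ?enum_uniq // => k l /tuple_uniqP /perm_inj; apply.
exact: ordering_uniq.
Qed.

Definition swap (i j : 'I_N) p : ordering n := Ordering (uniq_swap p i j).

Lemma swapE i j p k : tnth (swap i j p) k = tnth p (tperm i j k).
Proof. by rewrite tnth_mktuple. Qed.

Lemma swapK i j : involutive (swap i j).
Proof.
by move=> p; apply/val_inj/eq_from_tnth => k; rewrite !swapE tpermK.
Qed.

Lemma take_rcons_tnth p (i : 'I_N) : take i.+1 p = rcons (take i p) (tnth p i).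
Proof. by rewrite (tnth_nth (tnth p i)) -take_nth // size_tuple. Qed.

Lemma take_swap (i j : 'I_N) p : (i <= j)%N -> take i (swap i j p) = take i p.
Proof.
move=> leij; apply: (@eq_from_nth _ (tnth p i)) => [|k].
  by rewrite !size_take_min !size_tuple.
rewrite size_take size_tuple ltn_ord => ltki.
have kN : (k < N)%N := ltn_trans ltki (ltn_ord i).
rewrite !nth_take // -[k]/(nat_of_ord (Ordinal kN)) -!tnth_nth swapE tpermD //.
  by apply: contraTneq ltki => -> /=; rewrite ltnn.
by apply: contraTneq ltki => jk; rewrite -leqNgt (leq_trans leij) // jk.
Qed.

Lemma tnth_ordering_bij p : bijective (tnth p).
Proof.
apply: inj_card_bij; last by rewrite card_ord card_edge.
exact/tuple_uniqP/ordering_uniq.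
Qed.

Lemma mem_take_tnth p s (i : 'I_N) : (tnth p i \in take s p) = (i < s)%N.
Proof.
rewrite (tnth_nth (tnth p i)) in_take ?mem_nth ?size_tuple //.
by rewrite index_uniq ?size_tuple // ordering_uniq.
Qed.

(** Exchanging positions [s] and [i >= s] is an involution of the orderings that fixes the first [s]
    edges, so the next edge is uniform among the [N - s] unseen ones. Expectations are kept as
    unnormalised sums over orderings. *)
Lemma sum_next_edge (X : seq (edge n) -> R) (s : 'I_N) :
  \sum_(p : ordering n) \sum_(e : edge n | e \notin take s p) X (rcons (take s p) e) =
  (\sum_(p : ordering n) X (take s.+1 p)) *+ (N - s).
Proof.
have reindexE p : \sum_(e : edge n | e \notin take s p) X (rcons (take s p) e) =
    \sum_(i : 'I_N | (s <= i)%N) X (take s.+1 (swap s i p)).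
  rewrite (reindex (tnth p)); last first.
    by apply: onW_bij; apply: tnth_ordering_bij.
  apply: eq_big => [i|i]; first by rewrite mem_take_tnth -leqNgt.
  rewrite mem_take_tnth -leqNgt => lesi.
  by rewrite take_rcons_tnth take_swap // swapE tpermL.
under eq_bigr do rewrite reindexE.
rewrite exchange_big.
under eq_bigr => i _.
  rewrite (reindex_inj (inv_inj (@swapK s i))).
  under eq_bigr do rewrite swapK.
over.
rewrite sumr_const; congr (_ *+ _).
rewrite -(card_ord (N - s)).
have lt_shift (i : 'I_(N - s)) : (s + i < N)%N by rewrite -ltn_subRL.
pose g i := Ordinal (lt_shift i).
have g_inj : injective g.
  by move=> i j [] /addnI ij; apply: val_inj.
rewrite -(card_codom g_inj); apply: eq_card => j.
apply/idP/codomP => [|[i ->]]; last exact: leq_addr.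
move=> lesj0; have lesj : (s <= j)%N := lesj0.
have ltj : (j - s < N - s)%N by rewrite ltn_sub2r // ltn_ord.
by exists (Ordinal ltj); apply: val_inj; rewrite /= subnKC.
Qed.

Lemma supermartingale (X : seq (edge n) -> R) (c : R) s1 s2 :
    0 <= c -> (s1 <= s2 <= N)%N ->
    (forall h, uniq h -> (s1 <= size h < s2)%N ->
      \sum_(e : edge n | e \notin h) X (rcons h e) <= c * X h *+ (N - size h)) ->
  \sum_(p : ordering n) X (take s2 p) <= c ^+ (s2 - s1) * \sum_(p : ordering n) X (take s1 p).
Proof.
move=> c0 /andP[]; elim: s2 => [|s2 IH].
  by rewrite leqn0 => /eqP -> _ _; rewrite expr0 mul1r.
rewrite leq_eqVlt ltnS => /orP[/eqP -> _ _|les ltN HX].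
  by rewrite subnn expr0 mul1r.
apply: (@le_trans _ _ (c * \sum_(p : ordering n) X (take s2 p))); last first.
  rewrite subSn // exprS -mulrA ler_wpM2l // IH // ?(ltnW ltN) //.
  by move=> h uh /andP[h1 h2]; apply: HX; rewrite // h1 ltnS ltnW.
have N0 : (0 < N - s2)%N by rewrite subn_gt0.
rewrite -(ler_pMn2r N0) -(sum_next_edge X (Ordinal ltN)) mulr_sumr -sumrMnl.
apply: ler_sum => p _ /=.
have sz : size (take s2 p) = s2 by rewrite size_take size_tuple ltN.
have := HX _ (take_uniq s2 (ordering_uniq p)); rewrite sz; apply.
by rewrite les /=.
Qed.

(* [B ^ phi] is a supermartingale as long as the process is unfinished: each
   useful edge divides it by [B]. *)
Lemma unfinished_bound (unf : pred (seq (edge n))) (phi : seq (edge n) -> nat)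
    (K r s1 s2 : nat) (B : R) :
    1 <= B -> (r <= N)%N -> (s1 <= s2 <= N)%N ->
    (forall h, uniq h -> size h = s1 -> unf h -> (phi h <= K)%N) ->
    (forall h e, uniq h -> e \notin h -> (s1 <= size h < s2)%N ->
      unf (rcons h e) -> unf h /\ (phi (rcons h e) <= phi h)%N) ->
    (forall h, uniq h -> (s1 <= size h < s2)%N -> unf h ->
      (r <= #|[set e | (e \notin h) &&
                (unf (rcons h e) ==> (phi (rcons h e) < phi h)%N)]%SET|)%N) ->
  #|[set p : ordering n | unf (take s2 p)]%SET|%:R <=
    #|{: ordering n}|%:R * (B ^+ K * (1 - r%:R / N%:R * (1 - B^-1)) ^+ (s2 - s1)).
Proof.
move=> B1 rN sN phiK mono useful.
have B0 : 0 < B by apply: lt_le_trans B1.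
have iB : 0 <= B^-1 <= 1 by rewrite invr_ge0 ltW //= invf_le1.
set c := 1 - _.
have rN1 : 0 <= (r%:R / N%:R : R) <= 1.
  apply/andP; split; first by rewrite divr_ge0.
  have [->|N0] := posnP N; first by rewrite invr0 mulr0.
  by rewrite ler_pdivrMr ?ltr0n // mul1r ler_nat.
have c0 : 0 <= c by rewrite subr_ge0 mulr_ile1 //; lra.
(* [X] is at least 1 on unfinished histories, so its sum dominates their number; the value 0
   afterwards lets finishing count as progress. *)
pose X h : R := if unf h then B ^+ phi h else 0.
have X0 h : 0 <= X h by rewrite /X; case: ifP => // _; rewrite exprn_ge0 // ltW.
apply: (@le_trans _ _ (\sum_(p : ordering n) X (take s2 p))).
  rewrite -sum1_card natr_sum big_mkcond /=; apply: ler_sum => p _.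
  rewrite inE /X; case: ifP => // _; exact: exprn_ege1.
apply: (le_trans (supermartingale c0 sN _)).
  move=> h uh sh; rewrite {2}/X; case: ifPn => [unfh|nunf]; last first.
    rewrite mulr0 mul0rn big1 // => e eh; rewrite /X; case: ifP => // une.
    by have [] := mono h e uh eh sh une; rewrite (negPf nunf).
  have := useful h uh sh unfh; set W := [set e | _]%SET => rW.
  have cardN : #|[set e | e \notin h]%SET| = (N - size h)%N.
    have ch : #|[set e | e \in h]%SET| = size h by rewrite cardsE (card_uniqP uh).
    rewrite -card_edge -(cardsC [set e | e \in h]%SET) ch addKn.
    by apply: eq_card => e; rewrite !inE.
  have WN : W \subset [set e | e \notin h]%SET.
    by apply/fintype.subsetP => e; rewrite !inE => /andP[].
  apply: (@le_trans _ _
    (\sum_(e in [set e | e \notin h]%SET) (B ^+ phi h) *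
        (1 - (e \in W)%:R * (1 - B^-1)))).
    rewrite [leRHS](eq_bigl (fun e => e \notin h)); last by move=> e; rewrite inE.
    apply: ler_sum => e eh.
    have Bp : 0 <= B ^+ phi h by rewrite exprn_ge0 // ltW.
    case: (boolP (e \in W)) => [|_]; last first.
      rewrite mul0r subr0 mulr1 /X; case: ifP => // une.
      by rewrite ler_weXn2l //; have [] := mono h e uh eh sh une.
    rewrite !inE eh /= => eW; rewrite mul1r opprB addrC subrK /X.
    case: ifP eW => /= _; last by rewrite mulr_ge0 //; lra.
    by rewrite ler_pdivlMr // -exprSr => ?; rewrite ler_weXn2l.
  rewrite -mulr_sumr [c * _]mulrC -mulrnAr ler_wpM2l ?exprn_ge0 ?(ltW B0) //.
  rewrite sumrB sumr_const cardN -mulr_suml -natr_sum.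
  have -> : (\sum_(e in [set e | e \notin h]%SET) (e \in W) = #|W|)%N.
    rewrite -sum1_card [in RHS]big_mkcond /= [LHS]big_mkcond; apply: eq_bigr => e _.
    by case: (boolP (e \in W)) => [/(fintype.subsetP WN) ->|_] //=; case: ifP.
  have M0 : (0 < N - size h)%N by rewrite subn_gt0; lia.
  rewrite -[leRHS]mulr_natr /c mulrBl mul1r lerB // mulrAC ler_wpM2r //; first lra.
  (* A useful edge comes with chance at least [r / (N - size h)]; the weaker [r / N] does not depend
     on the round. *)
  apply: (@le_trans _ _ r%:R); last by rewrite ler_nat.
  have N0 : (0 < N)%N by lia.
  by rewrite mulrAC ler_pdivrMr ?ltr0n // ler_wpM2l // ler_nat leq_subr.
rewrite mulrC mulrA ler_wpM2r ?exprn_ge0 //.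
apply: (@le_trans _ _ (\sum_(p : ordering n) B ^+ K)); last first.
  by rewrite sumr_const mulr_natl.
apply: ler_sum => p _; rewrite /X; case: ifP => [une|]; last by rewrite exprn_ge0 ?ltW.
rewrite ler_weXn2l // phiK //; first exact/take_uniq/ordering_uniq.
by rewrite size_take_min size_tuple; lia.
Qed.
End Martingale.

(** * The edge-accepting process and its invariant *)

Section Process.
Import mathcomp.boot.fintype mathcomp.boot.finset mathcomp.boot.fingraph.
Local Open Scope nat_scope.
Local Open Scope set_scope.
Variables (n d u L M1 M2 : nat).
Local Notation T := 'I_n.
Local Notation blobs := {ffun T -> seq T}.
Local Notation state := ({set {set T}} * blobs)%type.
Implicit Types (P : blobs) (E : {set {set T}}) (v w x y a b : T).
Implicit Types (st : state) (h : seq (edge n)) (e : edge n).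

(* The classes [j < d] are the reservoirs in which giant trees are grown; class
   [d] consists of the remaining vertices, which are packed into paths. *)
Definition cls v := minn (v %/ u) d.

(* [P v] lists the blob of [v], in path order when [v] has class [d]; its last
   vertex serves as the representative of the blob. *)
Definition rp P v := last v (P v).

Definition at_head P v := head v (P v) == v.

(** In class [d] only paths shorter than [L] are joined, so no path reaches length [2 L]. Using one
    fixed end of each path costs only a constant factor in the number of useful edges. *)
Definition mergeable P x y :=
  [&& rp P x != rp P y, cls x == cls y &
      (cls x < d) || [&& at_head P x, at_head P y, size (P x) < L & size (P y) < L]].

(** Reversing the first list puts the heads [x] and [y] side by side, so paths stay paths. In a
    reservoir the order of the list carries no meaning. *)
Definition merge P x y : blobs :=
  [ffun v => if v \in P x ++ P y then rev (P x) ++ P y else P v].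

Definition good P v := (cls v == d) && (L <= size (P v)).

Definition giant P v := (cls v < d) && (u < (size (P v)).*2).

Definition inner P v := [&& good P v, ~~ at_head P v & rp P v != v].

Definition req P v := if inner P v then d - 2 else d.

(** Neighbouring blobs are counted through their representatives, so that one deleted vertex can
    spoil at most one of them. *)
Definition nbs st v :=
  [set rp st.2 y | y in [set y | [&& good st.2 y, rp st.2 y != rp st.2 v &
                                     [set v; y] \in st.1]]].

Definition deficient st v := #|nbs st v| < req st.2 v.

Definition helps st x y :=
  [&& deficient st x, good st.2 y, rp st.2 y != rp st.2 x & rp st.2 y \notin nbs st x].

Definition contact st v (j : nat) :=
  [exists ab : T * T, [&& ab.1 \in st.2 v, cls ab.2 == j, giant st.2 ab.2 &
                          [set ab.1; ab.2] \in st.1]].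

Definition hooks st x y := [&& good st.2 x, giant st.2 y & ~~ contact st x (cls y)].

Definition joins e (r : rel T) :=
  [exists xy : T * T, (edge_set e == [set xy.1; xy.2]) && r xy.1 xy.2].

Definition grow st e : state :=
  if [pick xy : T * T | (edge_set e == [set xy.1; xy.2]) && mergeable st.2 xy.1 xy.2]
  is Some xy then (edge_set e |: st.1, merge st.2 xy.1 xy.2) else st.

Definition wanted s st e :=
  if s < M2 then joins e (fun x y => helps st x y && helps st y x)
  else joins e (fun x y => helps st x y || hooks st x y).

Definition step s st e : state :=
  if s < M1 then grow st e
  else if wanted s st e then (edge_set e |: st.1, st.2) else st.

Fixpoint run_from s st h :=
  if h is e :: h' then run_from s.+1 (step s st e) h' else st.

Definition run h := run_from 0 (set0, [ffun v => [:: v]]) h.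

Lemma run_rcons h e : run (rcons h e) = step (size h) (run h) e.
Proof.
rewrite /run -[size h]addn0; elim: h 0 (_, _) => //= e' h IH s st.
by rewrite IH addSnnS.
Qed.

Lemma adj_sym E : symmetric (adj E).
Proof. by move=> x y; rewrite /adj eq_sym setUC. Qed.

Lemma adj_minus_sym E S : symmetric (adj_minus E S).
Proof. by move=> x y; rewrite /adj_minus adj_sym andbCA. Qed.

Lemma adj_mono E E' : E \subset E' -> subrel (adj E) (adj E').
Proof. by move=> /subsetP sE x y /andP[xy /sE Exy]; rewrite /adj xy. Qed.

Lemma sorted_rev_cat (X : Type) (r : rel X) (x : X) p q :
  symmetric r -> sorted r (x :: p) -> sorted r (x :: q) ->
  sorted r (rev p ++ x :: q).
Proof.
move=> rs; elim: p x q => //= z p IH x q /andP[rxz pz] xq.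
by rewrite rev_cons cat_rcons; apply: IH => //=; rewrite rs rxz.
Qed.

(** [inv_conn] speaks of all sets [S] that avoid the blob because the blob must be connected by its
    own vertices, whatever is deleted elsewhere. *)
Record inv st : Prop := Inv {
  inv_mem : forall v, v \in st.2 v;
  inv_uniq : forall v, uniq (st.2 v);
  inv_eq : forall v w, w \in st.2 v -> st.2 w = st.2 v;
  inv_cls : forall v w, w \in st.2 v -> cls w = cls v;
  inv_size : forall v, cls v = d -> size (st.2 v) < L.*2;
  inv_path : forall v, cls v = d -> sorted (adj st.1) (st.2 v);
  inv_conn : forall v (S : {set T}), {in st.2 v, forall a, a \notin S} ->
    {in st.2 v &, forall a b, connect (adj_minus st.1 S) a b}
}.

Lemma inv_init : 0 < L -> inv (set0, [ffun v => [:: v]]).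
Proof.
move=> L0; split=> [v|v|v w|v w|v|v|v S _ a b] /=; rewrite !ffunE ?inE //=.
- by move/eqP->.
- by move/eqP->.
- by lia.
- by move=> /eqP-> /eqP->.
Qed.

Lemma inv_sub E E' P : E \subset E' -> inv (E, P) -> inv (E', P).
Proof.
move=> sE [] /= i1 i2 i3 i4 i5 i6 i7; split => //= [v vd|v S vS a b av bv].
  by apply: sub_sorted (i6 v vd); apply: adj_mono.
apply: connect_sub (i7 v S vS a b av bv) => x y /and3P[xS yS xy].
by apply: connect1; rewrite /adj_minus xS yS (adj_mono sE).
Qed.

Section Facts.
Variables (st : state) (I : inv st).

Lemma mem_rp v : rp st.2 v \in st.2 v.
Proof. by rewrite /rp; have := inv_mem I v; case: (st.2 v) => //= z s _; exact: mem_last. Qed.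

Lemma rp_eqP v w : reflect (st.2 v = st.2 w) (rp st.2 v == rp st.2 w).
Proof.
apply: (iffP eqP) => vw.
  by rewrite -(inv_eq I (mem_rp v)) vw (inv_eq I (mem_rp w)).
rewrite /rp vw; have := inv_mem I w; case: (st.2 w) => //.
Qed.

Lemma mem_blob v w : (w \in st.2 v) = (rp st.2 w == rp st.2 v).
Proof.
apply/idP/rp_eqP => [/(inv_eq I)//|<-]; exact: inv_mem I _.
Qed.

End Facts.

Lemma inv_merge E P x y : inv (E, P) -> mergeable P x y -> [set x; y] \in E ->
  inv (E, merge P x y).
Proof.
move=> I /and3P[rpxy clsxy xyP] Exy; have [/= i1 i2 i3 i4 i5 i6 i7] := I.
have dis v : v \in P x -> v \notin P y.
  rewrite !(mem_blob I) => /eqP ->; exact: rpxy.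
set Q := rev (P x) ++ P y.
have memQ v : (v \in P x ++ P y) = (v \in Q) by rewrite !mem_cat mem_rev.
have mE v : merge P x y v = if v \in Q then Q else P v by rewrite ffunE memQ.
have closedQ v w : w \in P v -> (w \in Q) = (v \in Q).
  move=> wv; rewrite !mem_cat !mem_rev !(mem_blob I).
  by move: wv; rewrite (mem_blob I) => /eqP ->.
have clsQ v : v \in Q -> cls v = cls x.
  by rewrite mem_cat mem_rev => /orP[/i4|/i4 ->] //; rewrite (eqP clsxy).
have heads : cls x = d -> [&& at_head P x, at_head P y, size (P x) < L & size (P y) < L].
  by move=> xd; move: xyP; rewrite xd ltnn.
split=> [v|v|v w|v w|v|v|v S] /=; rewrite ?(mE v); case: (boolP (v \in Q)) => vQ //.
- rewrite cat_uniq rev_uniq !i2 andbT /=; apply/hasPn => z zy.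
  by rewrite mem_rev; apply: contraL zy; apply: dis.
- by rewrite mE => ->.
- by move=> wv; rewrite mE (closedQ _ _ wv) (negPf vQ); apply: i3.
- by move=> /clsQ ->; rewrite clsQ.
- by apply: i4.
- rewrite clsQ // => /heads /and4P[_ _ ? ?].
  by rewrite size_cat size_rev; lia.
- by apply: i5.
- rewrite clsQ // => xd; have /and4P[hx hy _ _] := heads xd.
  have yd : cls y = d by rewrite -(eqP clsxy).
  move: hx hy (i6 x xd) (i6 y yd) (i1 x) (i1 y); rewrite /Q /at_head.
  case: (P x) => // x' px; case: (P y) => // y' py /= /eqP-> /eqP-> px1 py1 _ _.
  rewrite rev_cons cat_rcons; apply: sorted_rev_cat => //=; first exact: adj_sym.
  rewrite py1 andbT /adj Exy andbT.
  by apply: contraNneq rpxy => ->.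
- by apply: i6.
- move=> QS a b; have xS : x \notin S by apply: QS; rewrite mem_cat mem_rev i1.
  have yS : y \notin S by apply: QS; rewrite mem_cat i1 orbT.
  have ax c : c \in Q -> connect (adj_minus E S) c x.
    rewrite mem_cat mem_rev => /orP[cx|cy].
      apply: (i7 x) => // z zx; apply: QS; by rewrite mem_cat mem_rev zx.
    apply: (@connect_trans _ _ y).
      apply: (i7 y) => // z zy; apply: QS; by rewrite mem_cat zy orbT.
    apply: connect1; rewrite /adj_minus yS xS /adj setUC Exy andbT eq_sym.
    by apply: contraNneq rpxy => ->.
  move=> /ax aQ /ax bQ; apply: connect_trans aQ _.
  by rewrite (sym_connect_sym (adj_minus_sym E S)).
- by move=> vS; apply: i7.
Qed.

Lemma growP st e : grow st e = st \/
  exists x y, [/\ edge_set e = [set x; y], mergeable st.2 x y &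
    grow st e = (edge_set e |: st.1, merge st.2 x y)].
Proof.
rewrite /grow; case: pickP => [[x y] /= /andP[/eqP exy m]|_]; last by left.
by right; exists x, y.
Qed.

Lemma inv_step s st e : inv st -> inv (step s st e).
Proof.
case: st => E P I; rewrite /step; case: ifP => _.
  case: (growP (E, P) e) => [->//|[x [y [exy m ->]]]] /=.
  apply: inv_merge m _; last by rewrite -exy setU11.
  exact: inv_sub (subsetU1 _ _) I.
case: ifP => // _; exact: inv_sub (subsetU1 _ _) I.
Qed.

Lemma inv_run h : 0 < L -> inv (run h).
Proof.
move=> L0; elim/last_ind: h => [|h e IH]; first exact: inv_init.
by rewrite run_rcons; apply: inv_step.
Qed.

End Process.

(** * Deterministic criterion for [d]-connectivity *)

Section Connectivity.
Import mathcomp.boot.fintype mathcomp.boot.finset mathcomp.boot.fingraph.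
Local Open Scope nat_scope.
Local Open Scope set_scope.
Variables (n d u L : nat).
Local Notation T := 'I_n.
Local Notation state := ({set {set T}} * {ffun T -> seq T})%type.
Local Notation cls := (@cls n d u).
Local Notation inv := (@inv n d u L).
Local Notation good := (@good n d u L).
Local Notation giant := (@giant n d u).
Local Notation inner := (@inner n d u L).
Local Notation req := (@req n d u L).
Local Notation nbs := (@nbs n d u L).
Local Notation contact := (@contact n d u).
Implicit Types (st : state) (v w x y : T).

Lemma card_cls j : 0 < u -> j < d -> #|[set v | cls v == j]| <= u.
Proof.
move=> u0 jd; pose f v := inord (v %% u) : 'I_u.-1.+1.
have fE v : f v = v %% u :> nat by rewrite inordK // prednK // ltn_pmod.
have cE v : v \in [set v | cls v == j] -> v %/ u = j.
  by rewrite inE /cls => /eqP; lia.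
suff /card_in_imset <- : {in [set v | cls v == j] &, injective f}.
  by apply: leq_trans (max_card _) _; rewrite card_ord prednK.
move=> v w /cE vj /cE wj /(congr1 val) /=; rewrite !fE => vw; apply: val_inj.
by rewrite /= (divn_eq v u) (divn_eq w u) vj wj vw.
Qed.

Lemma blob_disjoint st v w : inv st -> st.2 v <> st.2 w ->
  [disjoint st.2 v & st.2 w].
Proof.
move=> I nvw; apply/pred0P => z /=; apply/negP => /andP[/(inv_eq I) zv /(inv_eq I) zw].
by apply: nvw; rewrite -zv zw.
Qed.

(** Two disjoint blobs with more than [u / 2] vertices each do not fit into a class of at most [u]
    vertices. *)
Lemma giant_eq st v w : 0 < u -> inv st -> giant st.2 v -> giant st.2 w ->
  cls v = cls w -> st.2 v = st.2 w.
Proof.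
move=> u0 I /andP[vd gv] /andP[_ gw] vw; apply/eqP/negPn/negP => /eqP nvw.
have := card_cls u0 vd; apply/negP; rewrite -ltnNge.
suff : size (st.2 v ++ st.2 w) <= #|[set x | cls x == cls v]|.
  by rewrite size_cat; lia.
have us : uniq (st.2 v ++ st.2 w).
  rewrite cat_uniq !(inv_uniq I) andbT /=; apply/hasPn => z zw.
  by have := blob_disjoint I nvw; rewrite disjoint_sym => /disjointFr ->.
rewrite -(card_uniqP us); apply/subset_leq_card/subsetP => z.
by rewrite mem_cat inE vw => /orP[|] /(inv_cls I) ->; rewrite ?vw.
Qed.

Lemma pigeonhole_cls (S : {set T}) : #|S| < d -> exists2 j, j < d &
  forall v, v \in S -> cls v <> j.
Proof.
move=> Sd; pose f v := inord (cls v) : 'I_d.+1.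
have [j jd nj] : exists2 j : 'I_d.+1, j < d & j \notin f @: S.
  apply/exists_inP; apply: contraT => /existsPn H.
  have : #|[set j : 'I_d.+1 | j < d]| <= #|f @: S|.
    by apply/subset_leq_card/subsetP => j; have := H j; rewrite inE negb_and negbK => /orP[/negPf ->|].
  have -> : #|[set j : 'I_d.+1 | j < d]| = d.
    have -> : [set j : 'I_d.+1 | j < d] = [set~ ord_max].
      apply/setP => j; rewrite !inE -val_eqE /=.
      by have := ltn_ord j; rewrite ltnS leq_eqVlt; case: ltngtP.
    by rewrite cardsC1 card_ord.
  by rewrite leqNgt (leq_ltn_trans (leq_imset_card _ _)).
exists j => // v vS vj; case/negP: nj; apply/imsetP; exists v => //.
by apply: val_inj; rewrite /= inordK ?vj // ltnW.
Qed.

Lemma sorted_connect_in E (S : {set T}) x p :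
  sorted (adj E) (x :: p) -> {in x :: p, forall a, a \notin S} ->
  {in x :: p, forall a, connect (adj_minus E S) x a}.
Proof.
elim: p x => [|y p IH] x /=.
  by move=> _ _ a; rewrite inE => /eqP ->.
move=> /andP[xy yp] nS a; rewrite inE => /predU1P[-> //|ay].
apply: (@connect_trans _ _ y); last first.
  by apply: IH => // z zy; apply: nS; rewrite inE zy orbT.
by apply: connect1; rewrite /adj_minus xy !nS // !inE eqxx ?orbT.
Qed.

(* If the blob of [v] meets [S] then [v] either has an unharmed neighbouring blob
   or [S] hits its path only once, so that one of the two ends can be reached. *)
Lemma process_connected st : 0 < u -> d < n -> inv st ->
    (forall j, j < d -> exists2 b, giant st.2 b & cls b = j) ->
    (forall v, req st.2 v <= #|nbs st v|) ->
    (forall v j, good st.2 v -> j < d -> contact st v j) ->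
  d_connected st.1 d.
Proof.
move=> u0 dn I giants full contacts; rewrite /d_connected card_ord dn /=.
apply/forall_inP => S Sd; have [j jd Sj] := pigeonhole_cls Sd.
have [b0 gb0 b0j] := giants j jd.
pose conn := connect (adj_minus st.1 S).
have csym := sym_connect_sym (adj_minus_sym st.1 S).
suff H : forall v, v \notin S -> conn v b0.
  apply/forallP => x; apply/forallP => y; apply/implyP => /andP[/H xb /H yb].
  by rewrite (connect_trans xb) // csym.
have b0S : {in st.2 b0, forall z, z \notin S}.
  by move=> z /(inv_cls I) zb; apply/negP => /Sj; rewrite zb b0j.
have intact w : good st.2 w -> {in st.2 w, forall z, z \notin S} -> conn w b0.
  move=> gw wS; have /existsP[[a b] /= /and4P[aw /eqP bj gb Eab]] := contacts w j gw jd.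
  have bb0 : st.2 b = st.2 b0 by apply: giant_eq; rewrite ?bj ?b0j.
  have bin : b \in st.2 b0 by rewrite -bb0 (inv_mem I).
  apply: (connect_trans (inv_conn I wS (inv_mem I w) aw)).
  apply: (@connect_trans _ _ b); last first.
    exact: (inv_conn I b0S bin (inv_mem I b0)).
  apply: connect1; rewrite /adj_minus wS // b0S //= /adj Eab andbT.
  apply/negP => /eqP ab; have := inv_cls I aw; rewrite ab bj.
  by case/andP: gw => /eqP -> _; lia.
pose hitS w := [set rp st.2 s | s in S :\: [set z in st.2 w]].
(* A vertex of [S] lies in one blob only, and those in the blob of [v] harm no neighbouring blob. So
   some neighbouring blob is free of [S] and [intact] applies to it. *)
have escape v : v \notin S -> #|S :\: [set z in st.2 v]| < #|nbs st v| -> conn v b0.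
  move=> vS lt; have /subsetPn[c cn nhit] : ~~ (nbs st v \subset hitS v).
    apply: contraL lt => /subset_leq_card le; rewrite -leqNgt.
    exact: leq_trans le (leq_imset_card _ _).
  case/imsetP: cn nhit => y; rewrite inE => /and3P[gy ryv Evy] -> nhit.
  have yS : {in st.2 y, forall z, z \notin S}.
    move=> z zy; apply: contra nhit => zS; apply/imsetP; exists z.
      rewrite !inE zS andbT (mem_blob I).
      by move: zy; rewrite (mem_blob I) => /eqP ->.
    by move: zy; rewrite (mem_blob I) => /eqP ->.
  apply: connect_trans (intact y gy yS); apply: connect1.
  rewrite /adj_minus vS yS ?(inv_mem I y) //= /adj Evy andbT.
  by apply: contraNneq ryv => ->.
have outer v : v \notin S -> ~~ inner st.2 v -> conn v b0.
  move=> vS nin; apply: escape => //; apply: leq_trans (full v).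
  by rewrite /req (negPf nin) (leq_ltn_trans _ Sd) // subset_leq_card ?subsetDl.
move=> v vS; have [|/outer] := boolP (inner st.2 v); last exact.
move=> inn; have /and3P[gv nhv nlv] := inn.
(* If [escape] fails, at least [d - 2] of the at most [d - 1] vertices of [S] lie off the path, so
   at most one lies on it. *)
have [lt|ge] := ltnP #|S :\: [set z in st.2 v]| (d - 2).
  by apply: escape => //; apply: leq_trans (full v); rewrite /req inn.
have [|] := boolP (#|S :&: [set z in st.2 v]| == 0).
  rewrite cards_eq0 setI_eq0 => /disjointFl nS; apply: intact => // z zv.
  by rewrite nS // inE.
rewrite -lt0n => /card_gt0P[s]; rewrite !inE => /andP[sS sv].
have only : forall z, z \in st.2 v -> z \in S -> z = s.
  move=> z zv zS; apply/eqP/negPn/negP => zs.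
  have : #|[set z; s]| <= #|S :&: [set z in st.2 v]|.
    by apply/subset_leq_card/subsetP => y; rewrite !inE => /orP[]/eqP->; apply/andP.
  rewrite cards2 zs /= => c2; move: Sd; rewrite -(cardsID [set z in st.2 v] S).
  by move: #|S :&: _| #|S :\: _| c2 ge => a b; lia.
have vd : cls v = d by case/andP: gv => /eqP.
have rpv := mem_rp I v; have hv : head v (st.2 v) \in st.2 v.
  by have := inv_mem I v; case: (st.2 v) => //= z q _; rewrite mem_head.
have hdv : ~~ inner st.2 (head v (st.2 v)).
  rewrite /inner /at_head (inv_eq I hv) negb_and; apply/orP; right.
  by rewrite negb_and negbK; case: (st.2 v) (inv_mem I v) => //= ? ? _; rewrite eqxx.
have lsv : ~~ inner st.2 (rp st.2 v).
  rewrite /inner {3}/rp (inv_eq I rpv) /rp negb_and; apply/orP; right.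
  by rewrite negb_and !negbK; case: (st.2 v) (inv_mem I v) => //= ? ? _; rewrite eqxx orbT.
have vs : v != s by apply: contraNneq vS => ->.
have [l [r Pv]] : exists l r, st.2 v = l ++ s :: r by case/splitPr: sv => l r; exists l, r.
have nS z : z \in l ++ r -> z \notin S.
  move=> zlr; apply/negP => zS; have zs : z = s.
    by apply: only zS; rewrite Pv mem_cat inE orbCA -mem_cat zlr orbT.
  have := inv_uniq I v; rewrite Pv uniq_catC cat_cons cons_uniq mem_cat.
  by rewrite -zs orbC -mem_cat zlr.
have := inv_mem I v; have := inv_path I vd; rewrite Pv => sP.
(* Deleting [s] cuts the path into two segments. The one containing [v] also contains an end of the
   path, which is not inner and is therefore covered by [outer]. *)
rewrite mem_cat inE (negPf vs) => /orP[vl|/= vr].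
  case: l vl Pv nS sP => // z l vl Pv nS /cat_sorted2[sl _].
  have zb : conn z b0.
    apply: outer; first by apply: nS; rewrite mem_cat mem_head.
    by move: hdv; rewrite Pv.
  suff vz : conn v z by apply: connect_trans vz zb.
  rewrite /conn csym.
  apply: sorted_connect_in sl _ _ vl => y yl; apply: nS.
  by rewrite mem_cat yl.
move: sP; rewrite -cat_rcons => /cat_sorted2[_]; case/splitPr: vr Pv nS => r1 r2 Pv nS.
move=> /cat_sorted2[_ sr].
have rpE : rp st.2 v = last v r2 by rewrite /rp Pv last_cat /= last_cat.
have nS2 y : y \in v :: r2 -> y \notin S.
  by move=> yr; apply: nS; rewrite !mem_cat yr !orbT.
apply: (@connect_trans _ _ (last v r2)).
  by apply: sorted_connect_in sr nS2 _ _; exact: mem_last.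
by apply: outer; rewrite -?rpE // rpE nS2 // mem_last.
Qed.

End Connectivity.

(** * Counting the accepted edges *)

Section Budget.
Import mathcomp.boot.fintype mathcomp.boot.finset mathcomp.boot.fingraph.
Local Open Scope nat_scope.
Local Open Scope set_scope.
Variables (n d u L M1 M2 : nat).
Local Notation T := 'I_n.
Local Notation blobs := {ffun T -> seq T}.
Local Notation state := ({set {set T}} * blobs)%type.
Local Notation cls := (@cls n d u).
Local Notation inv := (@inv n d u L).
Local Notation good := (@good n d u L).
Local Notation inner := (@inner n d u L).
Local Notation req := (@req n d u L).
Local Notation nbs := (@nbs n d u L).
Local Notation deficient := (@deficient n d u L).
Local Notation helps := (@helps n d u L).
Local Notation hooks := (@hooks n d u L).
Local Notation contact := (@contact n d u).
Local Notation mergeable := (@mergeable n d u L).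
Local Notation wanted := (@wanted n d u L M2).
Local Notation step := (@step n d u L M1 M2).
Local Notation run := (@run n d u L M1 M2).
Implicit Types (st : state) (P : blobs) (E : {set {set T}}) (v w x y : T).
Implicit Types (h : seq (edge n)) (e : edge n).

Definition nclasses P := #|[set rp P v | v : T]|.

Lemma nclasses_merge E P x y : inv (E, P) -> mergeable P x y ->
  nclasses (merge P x y) < nclasses P.
Proof.
move=> I /andP[rxy _]; apply/proper_card/properP; split; last first.
  exists (rp P x); first exact: imset_f.
  apply/imsetP => -[v _]; rewrite /rp ffunE; case: ifP => [_|].
    rewrite last_cat; have := inv_mem I y; move: rxy; rewrite /rp /=.
    by case: (P y) => //= z q /eqP rxy _ /rxy.
  move=> nv /eqP /(rp_eqP I) /= xv; move: nv.
  by rewrite mem_cat xv (inv_mem I v).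
apply/subsetP => _ /imsetP[v _ ->]; rewrite /rp ffunE; case: ifP => _.
  apply/imsetP; exists y => //; rewrite last_cat /rp.
  by have := inv_mem I y => /=; case: (P y).
by apply/imsetP; exists v.
Qed.

(** Each accepted edge merges two blobs, and there are [n] blobs at the start: the accepted edges
    form a forest. *)
Lemma phase1_card h : 0 < L -> size h <= M1 ->
  #|(run h).1| + nclasses (run h).2 <= n.
Proof.
move=> L0; elim/last_ind: h => [_|h e IH].
  by rewrite cards0 add0n -[leqRHS]card_ord leq_imset_card.
rewrite size_rcons => hM; have {}IH := IH (ltnW hM).
rewrite run_rcons /step hM; have I := inv_run (n := n) d u M1 M2 h L0.
case: (run h) I IH => E P I IH.
have [-> //|[x [y [exy m ->]]]] := growP d u L (E, P) e.
rewrite /= cardsU1; have := nclasses_merge I m.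
by move: IH => /=; case: (_ \notin _); lia.
Qed.

Lemma step_sub s st e : st.1 \subset (step s st e).1.
Proof.
rewrite /step; case: ifP => _.
  have [-> //|[x [y [exy m ->]]]] := growP d u L st e; exact: subsetU1.
case: ifP => // _; exact: subsetU1.
Qed.

Lemma step_blobs s st e : M1 <= s -> (step s st e).2 = st.2.
Proof. by rewrite leqNgt /step => /negPf ->; case: ifP. Qed.

Lemma run_sub h s : (run (take s h)).1 \subset (run h).1.
Proof.
elim/last_ind: h => [//|h e IH]; rewrite -cats1 take_cat; case: ltnP => [hs|sh].
  rewrite cats1 run_rcons (subset_trans _ (step_sub _ _ _)) //.
case: (s - size h) => [|k] //=; rewrite cats0 cats1 run_rcons; exact: step_sub.
Qed.

Lemma run_blobs h s : M1 <= s -> s <= size h -> (run h).2 = (run (take s h)).2.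
Proof.
move=> Ms; elim/last_ind: h => [|h e IH].
  by rewrite leqn0 => /eqP ->.
rewrite size_rcons leq_eqVlt => /predU1P[->|]; first by rewrite take_oversize ?size_rcons.
rewrite ltnS => sh; rewrite run_rcons step_blobs ?(leq_trans Ms) // IH //.
by rewrite -cats1 takel_cat.
Qed.

Lemma nbs_sub E E' P v : E \subset E' -> nbs (E, P) v \subset nbs (E', P) v.
Proof.
move=> /subsetP sE; apply: imsetS; apply/subsetP => y; rewrite !inE /=.
by move=> /and3P[-> -> /sE].
Qed.

Lemma contact_sub E E' P v j : E \subset E' -> contact (E, P) v j -> contact (E', P) v j.
Proof.
move=> /subsetP sE /existsP[ab /= /and4P[a1 a2 a3 /sE a4]].
by apply/existsP; exists ab => /=; rewrite a1 a2 a3.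
Qed.

Definition def st v := req st.2 v - #|nbs st v|.

Lemma def_sub E E' P v : E \subset E' -> def (E', P) v <= def (E, P) v.
Proof. by move=> sE; rewrite leq_sub2l // subset_leq_card // nbs_sub. Qed.

Lemma def_helps E P e x y : edge_set e = [set x; y] -> helps (E, P) x y ->
  def (edge_set e |: E, P) x < def (E, P) x.
Proof.
move=> exy /and4P[dx gy ryx nry]; rewrite /def /= ltn_sub2l //.
apply/proper_card/properP; split; first by rewrite nbs_sub ?subsetU1.
by exists (rp P y) => //; apply/imsetP; exists y; rewrite // inE gy ryx -exy setU11.
Qed.

Definition deficit st := \sum_v def st v.

Definition missing st := [set vj : T * 'I_d |
  [&& good st.2 vj.1, rp st.2 vj.1 == vj.1 & ~~ contact st vj.1 vj.2]].

Lemma missing_sub E E' P : E \subset E' -> missing (E', P) \subset missing (E, P).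
Proof.
move=> sE; apply/subsetP => -[v j]; rewrite !inE /= => /and3P[-> ->].
by apply: contra; apply: contact_sub.
Qed.

(** A mutual edge lowers the deficit at both of its ends, which is why a unit of deficit costs only
    half an edge here. *)
Lemma phase2_card h : M1 <= size h <= M2 ->
  2 * #|(run h).1| + deficit (run h) <=
  2 * #|(run (take M1 h)).1| + deficit (run (take M1 h)).
Proof.
elim/last_ind: h => [|h e IH]; first by case/andP; rewrite leqn0 => /eqP ->.
rewrite size_rcons leq_eqVlt => /andP[/predU1P[->|]].
  by rewrite take_oversize ?size_rcons.
rewrite ltnS => Mh hM; have {}IH := IH _.
rewrite -cats1 takel_cat // cats1; apply: leq_trans (IH _); last by rewrite Mh ltnW.
rewrite run_rcons /step ltnNge Mh /= /wanted hM.
case: ifP => //; case: (run h) => E P /existsP[[x y] /= /andP[/eqP exy /andP[hxy hyx]]].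
have xy : x != y by case/and4P: hxy => _ _ ryx _; apply: contraNneq ryx => ->.
suff : deficit (edge_set e |: E, P) + 2 <= deficit (E, P).
  by rewrite cardsU1; case: (_ \notin _) => /=; lia.
have one z : \sum_(v : T) (v == z : nat) = 1.
  by rewrite (bigD1 z) //= eqxx big1 // => v /negPf ->.
rewrite -[2]/(1 + 1) -{1}(one x) -(one y) -!big_split /=; apply: leq_sum => v _.
have hyx' : edge_set e = [set y; x] by rewrite exy setUC.
have [->|vx] := eqVneq v x; first by rewrite (negPf xy) addn0 addn1 (def_helps exy hxy).
rewrite add0n; have [->|vy] := eqVneq v y; first by rewrite addn1 (def_helps hyx' hyx).
by rewrite addn0 def_sub ?subsetU1.
Qed.

Lemma contact_rp E P v j : inv (E, P) -> contact (E, P) (rp P v) j = contact (E, P) v j.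
Proof.
by move=> I; rewrite /contact /= (inv_eq I (mem_rp I v)).
Qed.

Lemma good_rp E P v : inv (E, P) -> good P (rp P v) = good P v.
Proof.
move=> I; rewrite /good (inv_eq I (mem_rp I v)).
by rewrite (inv_cls I (mem_rp I v)).
Qed.

Lemma rp_rp E P v : inv (E, P) -> rp P (rp P v) = rp P v.
Proof. by move=> I; apply/eqP/(rp_eqP I); rewrite (inv_eq I (mem_rp I v)). Qed.

Lemma missing_hooks E P e x y : inv (E, P) -> edge_set e = [set x; y] ->
    hooks (E, P) x y ->
  #|missing (edge_set e |: E, P)| < #|missing (E, P)|.
Proof.
move=> I exy /and3P[gx gy nc]; apply/proper_card/properP.
split; first by rewrite missing_sub ?subsetU1.
have yd : cls y < d by case/andP: gy.
exists (rp P x, Ordinal yd); rewrite inE /= (good_rp _ I) gx (rp_rp _ I) eqxx /=.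
  by rewrite (contact_rp _ _ I).
rewrite negbK; apply/existsP; exists (x, y) => /=.
by rewrite eqxx gy -exy setU11 (inv_eq I (mem_rp I x)) (inv_mem I).
Qed.

(** An edge may now serve one end only, so each unit of deficit and each missing contact is charged
    a full edge. *)
Lemma phase3_card h : 0 < L -> M1 <= M2 <= size h ->
  #|(run h).1| + deficit (run h) + #|missing (run h)| <=
  #|(run (take M2 h)).1| + deficit (run (take M2 h)) + #|missing (run (take M2 h))|.
Proof.
move=> L0; elim/last_ind: h => [|h e IH]; first by case/andP; case: M2.
rewrite size_rcons => /andP[M12]; rewrite leq_eqVlt => /predU1P[->|].
  by rewrite take_oversize ?size_rcons.
rewrite ltnS => Mh; have {}IH := IH _; rewrite M12 in IH.
rewrite -cats1 takel_cat // cats1; apply: leq_trans (IH Mh).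
rewrite run_rcons /step ltnNge (leq_trans M12 Mh) /= /wanted ltnNge Mh /=.
have := inv_run (n := n) d u M1 M2 h L0.
case: ifP => //; case: (run h) => E P /existsP[[x y] /= /andP[/eqP exy hxy]] I.
have cE : #|edge_set e |: E| <= #|E|.+1 by rewrite cardsU1; case: (_ \notin _).
have sE := subsetU1 (edge_set e) E.
case/orP: hxy => [hxy|hxy].
  suff : deficit (edge_set e |: E, P) < deficit (E, P).
    move=> lt; apply: leq_add (subset_leq_card (missing_sub P sE)).
    by apply: (leq_trans (leq_add cE (leqnn _))); rewrite addSn -addnS leq_add2l.
  rewrite /deficit (bigD1 x) //= [ltnRHS](bigD1 x) //=.
  rewrite -addSn leq_add ?(def_helps exy hxy) //.
  by apply: leq_sum => i _; rewrite def_sub.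
suff : deficit (edge_set e |: E, P) <= deficit (E, P).
  move=> le; rewrite -!addnA addnCA [leqRHS]addnCA; apply: leq_add le _.
  apply: (leq_trans (leq_add cE (leqnn _))).
  by rewrite addSn -addnS leq_add2l (missing_hooks I exy hxy).
by apply: leq_sum => i _; rewrite def_sub.
Qed.

Definition poor P := [set v | ~~ good P v].

Definition tails P := [set v | good P v && (rp P v == v)].

Lemma card_tails E P : inv (E, P) -> #|tails P| * L <= n.
Proof.
move=> I; rewrite -sum_nat_const -[leqRHS]card_ord -sum1_card.
rewrite [leqRHS](partition_big (rp P) predT) //= big_mkcond /=.
apply: leq_sum => v _; case: ifP => //; rewrite inE => /andP[/andP[_ gv] /eqP rv].
apply: leq_trans gv _; rewrite -(card_uniqP (inv_uniq I v)) sum1_card.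
by apply/subset_leq_card/subsetP => w; rewrite (mem_blob I) unfold_in /= rv.
Qed.

Lemma card_heads E P : inv (E, P) -> #|[set v | good P v && at_head P v]| <= #|tails P|.
Proof.
move=> I; rewrite -(card_in_imset (f := rp P)).
  apply/subset_leq_card/subsetP => _ /imsetP[v + ->]; rewrite !inE => /andP[gv _].
  by rewrite (good_rp _ I) gv (rp_rp _ I) eqxx.
move=> v w; rewrite !inE => /andP[_ /eqP hv] /andP[_ /eqP hw] /eqP /(rp_eqP I) /= vw.
by rewrite -hv -hw vw; have := inv_mem I w => /=; case: (P w).
Qed.

(** The vertices that are not inner are the poor ones and the two ends of each good path; each of
    them needs 2 more than [d - 2]. *)
Lemma sum_req E P : inv (E, P) -> 2 <= d ->
  \sum_v req P v <= (d - 2) * n + 2 * (#|poor P| + 2 * #|tails P|).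
Proof.
move=> I d2; have -> : \sum_v req P v = \sum_(v : T) (d - 2) + \sum_v 2 * ~~ inner P v.
  rewrite -big_split /=; apply: eq_bigr => v _; rewrite /req.
  by case: ifP => _ /=; lia.
rewrite sum_nat_const card_ord mulnC leq_add2l -big_distrr /= leq_mul2l /=.
have -> : \sum_v ~~ inner P v = #|[set v | ~~ inner P v]|.
  rewrite -sum1_card [RHS]big_mkcond /=; apply: eq_bigr => v _.
  by rewrite inE; case: (inner P v).
apply: (@leq_trans #|poor P :|: ([set v | good P v && at_head P v] :|: tails P)|).
  apply/subset_leq_card/subsetP => v; rewrite !inE /inner.
  by case: (good P v) => //=; rewrite negb_and !negbK.
apply: leq_trans (leq_card_setU _ _) _; rewrite leq_add2l.
apply: leq_trans (leq_card_setU _ _) _.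
by rewrite mul2n -addnn leq_add2r (card_heads I).
Qed.

(** Here [e], [D], [m] stand for edges, deficit and missing contacts at the ends of the phases, [p]
    for poor vertices, [t] for tails and [f] for the good vertices still deficient after the mutual
    phase. The leading [d * k] is [2 * k] for the forest plus [(d - 2) * k] for the requirements. *)
Lemma budget_arith (k p t f r D1 D2 D3 m2 m3 e1 e2 e3 : nat) : 2 <= d -> e1 <= k ->
    2 * e2 + D2 <= 2 * e1 + D1 -> e3 + D3 + m3 <= e2 + D2 + m2 -> D1 <= r ->
    r <= (d - 2) * k + 2 * (p + 2 * t) -> D2 <= d * (p + f) -> m2 <= d * t ->
  2 * e3 <= d * k + (d + 2) * p + (2 * d + 4) * t + d * f.
Proof.
case: d => [|[|d']] // _; rewrite subn2 /= !mulnDr !mulnDl; lia.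
Qed.

Lemma edges_bound h : 0 < L -> 2 <= d -> M1 <= M2 <= size h ->
  2 * #|(run h).1| <= d * n + (d + 2) * #|poor (run h).2| + (2 * d + 4) * #|tails (run h).2|
    + d * #|[set v | good (run h).2 v && deficient (run (take M2 h)) v]|.
Proof.
move=> L0 d2 /andP[M12 M2h].
have P12 := run_blobs (leqnn M1) (leq_trans M12 M2h).
have P2 := run_blobs M12 M2h.
have s2 : size (take M2 h) = M2 by rewrite size_take_min (minn_idPl M2h).
have := phase2_card (h := take M2 h); rewrite s2 M12 leqnn take_takel // => /(_ isT) p2.
have := phase3_card L0 (h := h); rewrite M12 M2h => /(_ isT) p3.
have s1 : size (take M1 h) <= M1 by rewrite size_take_min geq_minl.
have p1 : #|(run (take M1 h)).1| <= n.
  by apply: leq_trans (phase1_card L0 s1); exact: leq_addr.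
have I2 := inv_run (n := n) d u M1 M2 (take M2 h) L0.
have d1 : deficit (run (take M1 h)) <= \sum_v req (run h).2 v.
  by apply: leq_sum => v _; rewrite P12 /def leq_subr.
have r1 : \sum_v req (run h).2 v <=
    (d - 2) * n + 2 * (#|poor (run h).2| + 2 * #|tails (run h).2|).
  by apply: (@sum_req (run (take M2 h)).1) => //; rewrite P2; move: I2; case: run.
set D := [set v | _].
have d3 : deficit (run (take M2 h)) <= d * (#|poor (run h).2| + #|D|).
  apply: (@leq_trans (d * #|poor (run h).2 :|: D|)); last first.
    by rewrite leq_mul2l leq_card_setU orbT.
  rewrite mulnC -sum_nat_const [leqRHS]big_mkcond /=; apply: leq_sum => v _.
  rewrite !inE /def /deficient P2; case: ifP => [_|].
    by rewrite (leq_trans (leq_subr _ _)) // /req; case: ifP => // _; exact: leq_subr.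
  by case: good => //=; rewrite ltnNge leqn0 subn_eq0 => /negbFE.
have m3 : #|missing (run (take M2 h))| <= d * #|tails (run h).2|.
  rewrite mulnC -[X in _ * X]card_ord -[X in _ * X]cardsT -cardsX.
  apply/subset_leq_card/subsetP => -[v j]; rewrite !inE P2 /=.
  by case/and3P => -> ->.
exact: budget_arith d2 p1 p2 p3 d1 r1 d3 m3.
Qed.

End Budget.

(** * Lower bounds on the number of useful edges *)

Section Progress.
Import mathcomp.boot.fintype mathcomp.boot.finset mathcomp.boot.fingraph.
Local Open Scope nat_scope.
Local Open Scope set_scope.
Variables (n d u L : nat).
Local Notation T := 'I_n.
Local Notation blobs := {ffun T -> seq T}.
Local Notation state := ({set {set T}} * blobs)%type.
Local Notation cls := (@cls n d u).
Local Notation inv := (@inv n d u L).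
Local Notation good := (@good n d u L).
Local Notation giant := (@giant n d u).
Local Notation req := (@req n d u L).
Local Notation nbs := (@nbs n d u L).
Local Notation deficient := (@deficient n d u L).
Local Notation helps := (@helps n d u L).
Local Notation mergeable := (@mergeable n d u L).
Implicit Types (st : state) (P : blobs) (E : {set {set T}}) (v w x y : T).
Implicit Types (h : seq (edge n)) (e : edge n) (Q : {set T * T}) (X Y : {set T}).

Definition degree h v := count (fun e => v \in edge_set e) h.

Definition pair_set (xy : T * T) : {set T} := [set xy.1; xy.2].

Lemma pair_set_edges Q (r : rel T) :
    (forall x y, (x, y) \in Q -> x != y /\ r x y) ->
  pair_set @: Q \subset [set edge_set e | e in [set e | joins e r]].
Proof.
move=> Qr; apply/subsetP => _ /imsetP[[x y] /Qr[xy rxy] ->].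
have c2 : #|[set x; y]| == 2 by rewrite cards2 xy.
apply/imsetP; exists (Edge c2) => //; rewrite inE.
by apply/existsP; exists (x, y); rewrite /= eqxx.
Qed.

Lemma edge_set_inj : injective (@edge_set n).
Proof. by move=> e f ef; apply: val_inj. Qed.

Lemma pair_set_eq x y a b : a != b -> [set a; b] = [set x; y] ->
  (a, b) = (x, y) \/ (a, b) = (y, x).
Proof.
move=> ab E; have : a \in [set x; y] by rewrite -E set21.
have : b \in [set x; y] by rewrite -E set22.
rewrite !inE => /orP[]/eqP eb /orP[]/eqP ea; rewrite ea eb in ab *;
  by rewrite ?eqxx in ab; auto.
Qed.

Lemma card_pairs Q (r : rel T) :
    (forall x y, (x, y) \in Q -> x != y /\ r x y) ->
  #|Q| <= 2 * #|[set e | joins e r]|.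
Proof.
move=> Qr; rewrite -(card_imset _ edge_set_inj).
apply: leq_trans (_ : 2 * #|pair_set @: Q| <= _); last first.
  by rewrite leq_mul2l /= subset_leq_card // pair_set_edges.
rewrite mulnC -sum_nat_const -sum1_card (partition_big_imset pair_set) /=.
apply: leq_sum => _ /imsetP[[x y] xyQ ->].
rewrite sum1_card; apply: (@leq_trans #|[set (x, y); (y, x)]|).
  apply/subset_leq_card/subsetP => -[a b]; rewrite unfold_in !inE => /andP[abQ /eqP abxy].
  have [ab _] := Qr _ _ abQ; apply/orP.
  by have [->|->] := pair_set_eq ab abxy; rewrite eqxx; auto.
by rewrite cards2; case: (_ != _).
Qed.

(** Writing off every proposed edge is affordable in the first two phases, where the useful edges
    are of order [n ^ 2]. *)
Lemma card_joins_new h (r : rel T) :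
  #|[set e | joins e r]| - size h <= #|[set e | (e \notin h) && joins e r]|.
Proof.
rewrite leq_subLR -(cardsID [set e in h] [set e | joins e r]); apply: leq_add.
  rewrite (leq_trans _ (card_size h)) //; apply/subset_leq_card/subsetP => e.
  by rewrite !inE => /andP[].
by apply/subset_leq_card/subsetP => e; rewrite !inE.
Qed.

Lemma card_bigcup_le (I T' : finType) (A : {set I}) (F : I -> {set T'}) k :
  {in A, forall i, #|F i| <= k} -> #|\bigcup_(i in A) F i| <= #|A| * k.
Proof.
move=> Fk; rewrite -sum_nat_const.
elim/big_rec2: _ => [|i m B iA le]; first by rewrite cards0.
by apply: leq_trans (leq_card_setU _ _) _; apply: leq_add => //; exact: Fk.
Qed.

Lemma card_dep_pairs X (r : rel T) :
  #|[set xy | (xy.1 \in X) && r xy.1 xy.2]| = \sum_(x in X) #|[set y | r x y]|.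
Proof.
under eq_bigr do rewrite -sum1_card.
rewrite pair_big_dep -sum1_card; apply: eq_bigl => xy.
by rewrite !inE.
Qed.

(** In the last phase a single requirement has only about [n] useful edges, fewer than the rounds
    played. Only the proposed edges at the vertices of [X] may be written off, which is where the
    degree cap [k] enters. *)
Lemma card_cross h X Y k (r : rel T) : [disjoint X & Y] ->
    {in X & Y, forall x y, r x y} -> {in X, forall x, degree h x <= k} ->
  #|X| * (#|Y| - k) <= #|[set e | (e \notin h) && joins e r]|.
Proof.
move=> dXY rXY dk; pose rXYb := (fun x y => [&& x \in X, y \in Y & r x y]) : rel T.
apply: leq_trans (_ : #|[set e | (e \notin h) && joins e rXYb]| <= _); last first.
  apply/subset_leq_card/subsetP => e; rewrite !inE => /andP[-> /existsP[xy]].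
  by move=> /and4P[exy _ _ rxy]; apply/existsP; exists xy; rewrite exy.
rewrite mulnBr leq_subLR addnC.
apply: leq_trans (_ : #|[set e | joins e rXYb]| <= _).
  rewrite -cardsX -(card_imset _ edge_set_inj).
  have inXY x y : (x, y) \in setX X Y -> x != y.
    rewrite inE /= => /andP[xX yY]; apply: contraTneq yY => <-.
    by rewrite (disjointFr dXY xX).
  rewrite -(card_in_imset (f := pair_set)).
    apply/subset_leq_card/pair_set_edges => x y xy; split; first exact: inXY xy.
    by move: xy; rewrite inE /= => /andP[xX yY]; rewrite /rXYb xX yY rXY.
  move=> [x y] [a b] xyXY abXY E.
  have [[-> ->]//|[xb ya]] := pair_set_eq (inXY _ _ xyXY) E.
  move: xyXY abXY; rewrite !inE /= xb ya => /andP[bX _] /andP[_ bY].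
  by rewrite (disjointFr dXY bX) in bY.
rewrite -(cardsID [set e in h]) addnC; apply: leq_add.
  by apply/subset_leq_card/subsetP => e; rewrite !inE.
apply: leq_trans (_ : #|\bigcup_(x in X) [set e in h | x \in edge_set e]| <= _).
  apply/subset_leq_card/subsetP => e; rewrite !inE => /andP[/existsP[[x y]]].
  move=> /= /and4P[/eqP exy xX _ _] eh; apply/bigcupP; exists x => //.
  by rewrite !inE eh exy set21.
apply: card_bigcup_le => x xX.
apply: leq_trans (dk x xX); rewrite /degree -size_filter.
apply: leq_trans (card_size _); apply/subset_leq_card/subsetP => e.
by rewrite inE mem_filter andbC.
Qed.

Lemma blob_card E P v : inv (E, P) -> #|[set w | rp P w == rp P v]| = size (P v).
Proof.
move=> I; rewrite -(card_uniqP (inv_uniq I v)) cardsE; apply: eq_card => w.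
by rewrite (mem_blob I).
Qed.

Definition lacking P := (u < #|[set v | (cls v == d) && (size (P v) < L)]|) ||
  [exists j : 'I_d, [forall (b | cls b == j), ~~ giant P b]].

Lemma card_cls_eq j : 0 < u -> j < d -> d * u <= n -> #|[set v | cls v == j]| = u.
Proof.
move=> u0 jd dun; apply/eqP; rewrite eqn_leq card_cls //=.
have ltn_shift (i : 'I_u) : j * u + i < n.
  apply: leq_trans dun; apply: (@leq_trans (j.+1 * u)); last by rewrite leq_mul2r jd orbT.
  by rewrite mulSn addnC ltn_add2r.
pose f i := Ordinal (ltn_shift i).
have f_inj : injective f by move=> i k [] /addnI ik; apply: val_inj.
rewrite -[leqLHS]card_ord -(card_imset _ f_inj).
apply/subset_leq_card/subsetP => _ /imsetP[i _ ->]; rewrite inE /cls /=.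
by rewrite divnMDl // divn_small // addn0; apply/eqP/minn_idPl/ltnW.
Qed.

(** If more than [u] vertices lie on short paths, there are at least [u / L] such paths and their
    heads are pairwise mergeable. If a reservoir has no giant, each of its [u] vertices has at least
    [u / 2] partners outside its component. *)
Lemma merge_progress E P : 0 < u -> 0 < L -> d * u <= n -> inv (E, P) -> lacking P ->
  (u %/ L) * (u %/ L - 1) <= 4 * #|[set e | joins e (mergeable P)]|.
Proof.
move=> u0 L0 dun I; set q := u %/ L; rewrite -[4]/(2 * 2) -mulnA.
have qu : q <= u by exact: leq_div.
case/orP => [small|/existsP[j /forall_inP nog]].
  pose H := [set v | [&& cls v == d, size (P v) < L & at_head P v]].
  have Hrp : {in H &, injective (rp P)}.
    move=> v w; rewrite !inE => /and3P[_ _ /eqP hv] /and3P[_ _ /eqP hw].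
    move=> /eqP/(rp_eqP I) /= vw; rewrite -hv -hw vw.
    by have := inv_mem I w => /=; case: (P w).
  have qH : q <= #|H|.
    rewrite -ltnS ltn_divLR //; apply: leq_trans small _.
    apply: (@leq_trans (#|H| * L)); last by rewrite leq_mul2r leqnSn orbT.
    apply: leq_trans (_ : #|\bigcup_(v in H) [set w | rp P w == rp P v]| <= _).
      apply/subset_leq_card/subsetP => v; rewrite inE => /andP[/eqP vd sv].
      have hv : head v (P v) \in P v.
        by have := inv_mem I v => /=; case: (P v) => //= z s _; rewrite mem_head.
      have Ph := inv_eq I hv; rewrite /= in Ph.
      apply/bigcupP; exists (head v (P v)); last by rewrite inE; apply/(rp_eqP I).
      rewrite inE (inv_cls I hv) vd eqxx Ph sv /at_head Ph /=.
      by have := inv_mem I v => /=; case: (P v).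
    apply: card_bigcup_le => v; rewrite inE => /and3P[_ sv _].
    by rewrite (blob_card v I) ltnW.
  apply: (@leq_trans (#|H| * (#|H| - 1))).
    by apply: leq_mul => //; apply: leq_sub2r.
  apply: (@leq_trans (2 * #|[set e | joins e (mergeable P)]|)); last first.
    by rewrite leq_mul2l /= leq_pmull.
  have <- : #|[set xy : T * T | [&& xy.1 \in H, xy.2 \in H & xy.1 != xy.2]]| =
            #|H| * (#|H| - 1).
    rewrite (card_dep_pairs H (fun x y => (y \in H) && (x != y))) -sum_nat_const.
    apply: eq_bigr => x xH; rewrite (cardsD1 x H) xH add1n subn1 /=.
    by apply: eq_card => y; rewrite !inE (eq_sym x) [RHS]andbC.
  apply: card_pairs => x y; rewrite inE /= => /and3P[xH yH xy]; split => //.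
  have rxy : rp P x != rp P y by apply: contra xy => /eqP /Hrp ->.
  move: xH yH; rewrite !inE /mergeable rxy /= => /and3P[/eqP -> -> ->] /and3P[/eqP -> -> ->].
  by rewrite eqxx orbT.
apply: leq_trans (_ : 2 * #|[set xy : T * T |
    [&& cls xy.1 == j, cls xy.2 == j & rp P xy.1 != rp P xy.2]]| <= _); last first.
  rewrite leq_mul2l /=; apply: card_pairs => x y; rewrite inE /= => /and3P[/eqP xj /eqP yj rxy].
  split; first by apply: contraNneq rxy => ->.
  by rewrite /mergeable rxy xj yj eqxx ltn_ord.
have -> : [set xy : T * T | [&& cls xy.1 == j, cls xy.2 == j & rp P xy.1 != rp P xy.2]] =
    [set xy | (xy.1 \in [set x | cls x == j]) && ((cls xy.2 == j) && (rp P xy.1 != rp P xy.2))].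
  by apply/setP => xy; rewrite !inE.
rewrite (card_dep_pairs _ (fun x y => (cls y == j) && (rp P x != rp P y))).
apply: (@leq_trans (2 * (u * (u - u./2)))).
  apply: (@leq_trans (u * u)); first by apply: leq_mul => //; lia.
  by rewrite mulnCA leq_mul2l; apply/orP; right; lia.
rewrite leq_mul2l /= -[X in X * _](card_cls_eq u0 (ltn_ord j) dun) -sum_nat_const.
apply: leq_sum => x; rewrite inE => /eqP xj; rewrite leq_subLR.
rewrite -[X in X <= _](card_cls_eq u0 (ltn_ord j) dun).
rewrite -(cardsID [set y | rp P y == rp P x]); apply: leq_add.
  apply: (@leq_trans (size (P x))).
    by rewrite -(blob_card x I) subset_leq_card // subsetIr.
  by move: (nog x); rewrite /giant xj ltn_ord eqxx /= => /(_ isT); lia.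
apply/subset_leq_card/subsetP => y; rewrite !inE eq_sym andbC; by case/andP => -> ->.
Qed.

Definition shunned st x := [set y | good st.2 y &&
  ((rp st.2 y == rp st.2 x) || (rp st.2 y \in nbs st x))].

(** The blob of [x] and its fewer than [d] neighbouring blobs are at most [d] blobs, each with fewer
    than [2 L] vertices. *)
Lemma card_shunned E P x : inv (E, P) -> deficient (E, P) x ->
  #|shunned (E, P) x| <= d * L.*2.
Proof.
move=> I dx; pose A := rp P x |: nbs (E, P) x.
apply: leq_trans (_ : #|\bigcup_(r in A) [set y | good P y && (rp P y == r)]| <= _).
  apply/subset_leq_card/subsetP => y; rewrite inE => /andP[gy yx].
  by apply/bigcupP; exists (rp P y); rewrite !inE ?gy //= eqxx.
apply: (@leq_trans (#|A| * L.*2)).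
  apply: card_bigcup_le => r _; set B := [set _ | _].
  have [->|[y]] := set_0Vmem B; first by rewrite cards0.
  rewrite inE => /andP[/andP[/eqP yd _] /eqP yr].
  apply: leq_trans (ltnW (inv_size I yd)); rewrite /= -(blob_card y I) yr.
  by apply/subset_leq_card/subsetP => w; rewrite !inE => /andP[].
rewrite leq_mul2r; apply/orP; right.
have reqd : req P x <= d by rewrite /req; case: ifP => // _; exact: leq_subr.
apply: leq_trans reqd; apply: leq_trans dx; rewrite /A cardsU1.
by case: (_ \notin _).
Qed.

Lemma helps_notin_shunned st x y : helps st x y =
  [&& deficient st x, good st.2 y & y \notin shunned st x].
Proof.
by rewrite /helps inE; case: good => //=; rewrite ?andbF // negb_or.
Qed.

Lemma help2_progress E P (G := [set v | good P v && deficient (E, P) v]) :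
    inv (E, P) ->
  #|G| * (#|G| - d * (4 * L)) <=
    2 * #|[set e | joins e (fun x y => helps (E, P) x y && helps (E, P) y x)]|.
Proof.
move=> I; pose B := [set xy | (xy.1 \in G) && (xy.2 \in shunned (E, P) xy.1)].
pose swap (xy : T * T) := (xy.2, xy.1).
pose Q := setX G G :\: (B :|: swap @: B).
apply: (@leq_trans #|Q|); last first.
  apply: card_pairs => x y; rewrite inE in_setU negb_or => /andP[/andP[xyB yxB]].
  rewrite in_setX !inE /= => /andP[/andP[gx dx] /andP[gy dy]].
  have nx : y \notin shunned (E, P) x.
    by apply: contra xyB; rewrite !inE /= gx dx.
  have ny : x \notin shunned (E, P) y.
    apply: contra yxB => xy; apply/imsetP; exists (y, x) => //.
    by rewrite inE /= inE gy dy.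
  split; last by rewrite !helps_notin_shunned /= gx gy dx dy nx ny.
  by apply: contraNneq nx => ->; rewrite inE /= gy eqxx.
have cB : #|B| <= #|G| * (d * L.*2).
  rewrite (card_dep_pairs G (fun x y => y \in shunned (E, P) x)) -sum_nat_const.
  apply: leq_sum => x; rewrite inE => /andP[_ dx].
  by apply: leq_trans (card_shunned I dx); rewrite cardsE.
have csB : #|swap @: B| <= #|B| by exact: leq_imset_card.
rewrite mulnBr leq_subLR -cardsX -(cardsID (B :|: swap @: B) (setX G G)).
apply: leq_add => //; apply: leq_trans (subset_leq_card (subsetIr _ _)) _.
apply: leq_trans (leq_card_setU _ _) _.
have -> : #|G| * (d * (4 * L)) = #|G| * (d * L.*2) + #|G| * (d * L.*2).
  by rewrite -!mulnDr; congr (_ * (_ * _)); lia.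
by apply: leq_add => //; apply: leq_trans csB cB.
Qed.

Lemma help_progress E P h x k : inv (E, P) -> deficient (E, P) x ->
    degree h x <= k ->
  n - #|poor d u L P| - d * L.*2 - k <=
    #|[set e | (e \notin h) && joins e (fun x' y => (x' == x) && helps (E, P) x y)]|.
Proof.
move=> I dx dk; set Y := [set y | good P y && (y \notin shunned (E, P) x)].
apply: (@leq_trans (#|[set x]| * (#|Y| - k))).
  rewrite cards1 mul1n leq_sub2r // leq_subLR.
  have <- : #|~: poor d u L P| = n - #|poor d u L P|.
    by have := cardsC (poor d u L P); rewrite card_ord => cC; apply/eqP; rewrite -(eqn_add2l #|poor d u L P|) cC subnKC // -[leqRHS]cC leq_addr.
  apply: leq_trans (leq_add (card_shunned I dx) (leqnn _)).
  apply: leq_trans (leq_card_setU _ _); apply/subset_leq_card/subsetP => y.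
  by rewrite in_setU !inE negbK => gy; rewrite gy /= orbN.
apply: card_cross => [|x' y|x'].
- by rewrite disjoints1 /Y !inE /= eqxx /= andbT andbN.
- by rewrite in_set1 [y \in Y]in_set => /eqP -> /andP[gy ny]; rewrite eqxx helps_notin_shunned /= gy dx ny.
- by rewrite inE => /eqP ->.
Qed.

Lemma hook_progress E P h x b k : inv (E, P) -> good P x -> giant P b ->
    ~~ contact d u (E, P) x (cls b) -> (forall v, degree h v <= k) ->
  L * (u./2 - k) <= #|[set e | (e \notin h) &&
    joins e (fun x' y => [&& x' \in P x, y \in P b & hooks d u L (E, P) x' y])]|.
Proof.
move=> I gx gb nc dk; have /andP[bd ub] := gb; have /andP[xd Lx] := gx.
apply: leq_trans (_ : #|[set a in P x]| * (#|[set y in P b]| - k) <= _).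
  rewrite !cardsE !(card_uniqP (inv_uniq I _)); apply: leq_mul => //.
  by apply: leq_sub2r; rewrite -(doubleK (size (P b))) half_leq // ltnW.
apply: card_cross => [|x' y|x' _]; last exact: dk.
  apply/pred0P => z /=; rewrite !inE; apply/negP => /andP[/(inv_cls I) zx /(inv_cls I) zb].
  by move: bd; rewrite -zb zx (eqP xd) ltnn.
rewrite !inE => x'x yb; rewrite x'x yb /hooks /good /giant /=.
have Px := inv_eq I x'x; have Pb := inv_eq I yb; rewrite /= in Px Pb.
rewrite Px Pb (inv_cls I x'x) (inv_cls I yb) xd Lx bd ub /=.
by apply: contra nc; rewrite /contact /= Px.
Qed.

End Progress.

(** * Probability that a requirement stays unfinished *)

Section Events.
Import mathcomp.boot.fintype mathcomp.boot.finset mathcomp.boot.fingraph.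
Local Open Scope nat_scope.
Local Open Scope set_scope.
Variables (R : realType) (n d u L M1 M2 : nat).
Hypotheses (u0 : 0 < u) (L0 : 0 < L) (M12 : M1 <= M2).
Local Notation T := 'I_n.
Local Notation N := 'C(n, 2).
Local Notation blobs := {ffun T -> seq T}.
Local Notation state := ({set {set T}} * blobs)%type.
Local Notation cls := (@cls n d u).
Local Notation inv := (@inv n d u L).
Local Notation good := (@good n d u L).
Local Notation giant := (@giant n d u).
Local Notation deficient := (@deficient n d u L).
Local Notation helps := (@helps n d u L).
Local Notation mergeable := (@mergeable n d u L).
Local Notation contact := (@contact n d u).
Local Notation lacking := (@lacking n d u L).
Local Notation poor := (@poor n d u L).
Local Notation def := (@def n d u L).
Local Notation step := (@step n d u L M1 M2).
Local Notation run := (@run n d u L M1 M2).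
Implicit Types (st : state) (P : blobs) (E : {set {set T}}) (v w x y : T).
Implicit Types (h : seq (edge n)) (e : edge n).

Local Notation bound r K B s :=
  (#|{: ordering n}|%:R * (B ^+ K * (1 - r%:R / N%:R * (1 - B^-1)) ^+ s))%R.

Lemma size_merge E P x y v : inv (E, P) -> size (P v) <= size (merge P x y v).
Proof.
move=> I; rewrite ffunE; case: ifP => //; rewrite mem_cat size_cat size_rev.
by case/orP => /(inv_eq I) /= ->; lia.
Qed.

Lemma lacking_merge E P x y : inv (E, P) -> lacking (merge P x y) -> lacking P.
Proof.
move=> I /orP[small|/existsP[j /forall_inP nog]]; apply/orP; [left|right].
  apply: leq_trans small _; apply/subset_leq_card/subsetP => v; rewrite !inE.
  by case/andP => -> /(leq_ltn_trans (size_merge x y v I)).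
apply/existsP; exists j; apply/forall_inP => b bj; apply: contra (nog b bj).
by rewrite /giant => /andP[-> ub]; rewrite (leq_trans ub) // leq_double (size_merge _ _ _ I).
Qed.

Lemma joins_growP st e : joins e (mergeable st.2) ->
  exists x y, [/\ edge_set e = [set x; y], mergeable st.2 x y &
    grow d u L st e = (edge_set e |: st.1, merge st.2 x y)].
Proof.
move=> /existsP[xy exy]; rewrite /grow; case: pickP => [[x y] /= /andP[/eqP ? ?]|/(_ xy)].
  by exists x, y.
by rewrite exy.
Qed.

Lemma lacking_bound (r : nat) : d * u <= n -> M1 <= N -> r <= N ->
    4 * (r + M1) <= u %/ L * (u %/ L - 1) ->
  (#|[set p : ordering n | lacking (run (take M1 p)).2]|%:R <= bound r n (2%:R : R) M1)%R.
Proof.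
move=> dun MN rN rM; have := @unfinished_bound R n (fun h => lacking (run h).2)
  (fun h => nclasses (run h).2) n r 0 M1 2%:R; rewrite subn0; apply => //.
- by rewrite ler1n.
- by move=> h _ _ _; rewrite -[leqRHS]card_ord leq_imset_card.
- move=> h e uh eh /andP[_ hM]; rewrite run_rcons /step hM.
  have := inv_run (n := n) d u M1 M2 h L0; case: (run h) => E P I.
  have [-> //|[x [y [exy m ->]]]] := growP d u L (E, P) e => /=.
  by move=> /(lacking_merge I); split => //; apply/ltnW/(nclasses_merge I).
move=> h uh /andP[_ hM] lh.
have I := inv_run (n := n) d u M1 M2 h L0.
apply: (@leq_trans (#|[set e | joins e (mergeable (run h).2)]| - size h)).
  suff rA : r + size h <= #|[set e | joins e (mergeable (run h).2)]| by rewrite leq_subRL; lia.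
  have := @merge_progress n d u L (run h).1 (run h).2 u0 L0 dun.
  rewrite -surjective_pairing => /(_ I lh); lia.
apply: leq_trans (card_joins_new _ _) _; apply/subset_leq_card/subsetP => e.
rewrite !inE => /andP[-> /joins_growP[x [y [exy m g]]]] /=; apply/implyP => _.
rewrite run_rcons /step hM g /=; apply: (@nclasses_merge n d u L (run h).1) => //.
by rewrite -surjective_pairing.
Qed.

Lemma deficient_sub st E' v : st.1 \subset E' -> deficient (E', st.2) v -> deficient st v.
Proof.
case: st => E P /= sE; apply: leq_ltn_trans; exact/subset_leq_card/nbs_sub.
Qed.

Lemma stepE s st e : M1 <= s -> step s st e =
  if wanted d u L M2 s st e then (edge_set e |: st.1, st.2) else st.
Proof. by rewrite /step leqNgt => /negPf ->. Qed.

Lemma deficient_step s st e v : M1 <= s -> deficient (step s st e) v -> deficient st v.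
Proof.
move=> Ms; have := step_sub d u L M1 M2 s st e; have := step_blobs d u L M2 st e Ms.
by case: (step _ _ _) => E' P' /= -> ; apply: deficient_sub.
Qed.

Lemma def_step s st e v : M1 <= s -> def (step s st e) v <= def st v.
Proof.
move=> Ms; have := step_sub d u L M1 M2 s st e; have := step_blobs d u L M2 st e Ms.
by case: (step _ _ _) => E' P' /= ->; case: st => E P /= /def_sub ->.
Qed.

Lemma def_step_helps s st e x y : M1 <= s -> wanted d u L M2 s st e ->
  edge_set e = [set x; y] -> helps st x y -> def (step s st e) x < def st x.
Proof.
by move=> Ms w exy hxy; rewrite stepE // w; case: st hxy {w} => E P; apply: def_helps.
Qed.

Definition needy h := [set v | good (run h).2 v && deficient (run h) v].

Lemma needy_bound (r : nat) : M2 <= N -> r <= N ->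
    2 * (r + M2) <= u * (u - d * (4 * L)) ->
  (#|[set p : ordering n | (u < #|needy (take M2 p)|)%N]|%:R <=
    bound r (d * n)%N (2%:R : R) (M2 - M1)%N)%R.
Proof.
move=> MN rN rM; apply: (unfinished_bound (unf := fun h => u < #|needy h|)
  (phi := fun h => deficit d u L (run h))) => //; rewrite ?ler1n ?M12 //.
- move=> h _ _ _; rewrite mulnC -[X in X * d]card_ord -sum_nat_const.
  apply: leq_sum => v _; rewrite (leq_trans (leq_subr _ _)) // /req.
  by case: ifP => // _; exact: leq_subr.
- move=> h e uh eh /andP[Mh hM]; rewrite /needy run_rcons => lt; split.
    apply: leq_trans lt _; apply/subset_leq_card/subsetP => v; rewrite !inE step_blobs //.
    by move=> /andP[-> /(deficient_step Mh)].
  by apply: leq_sum => v _; apply: def_step.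
move=> h uh /andP[Mh hM] lh.
have I := inv_run (n := n) d u M1 M2 h L0; rewrite (surjective_pairing (run h)) in I.
have := help2_progress I; rewrite -surjective_pairing -/(needy h) => hp.
set r2 := (fun x y => _) in hp.
apply: (@leq_trans (#|[set e | joins e r2]| - size h)).
  suff rA : r + size h <= #|[set e | joins e r2]| by rewrite leq_subRL; lia.
  have : u * (u - d * (4 * L)) <= #|needy h| * (#|needy h| - d * (4 * L)).
    by apply: leq_mul; rewrite ?leq_sub2r // ltnW.
  lia.
apply: leq_trans (card_joins_new _ _) _; apply/subset_leq_card/subsetP => e.
rewrite !inE => /andP[-> je] /=; apply/implyP => _.
have w : wanted d u L M2 (size h) (run h) e by rewrite /wanted hM.
case/existsP: je => -[x y] /= /andP[/eqP exy /andP[hxy hyx]].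
rewrite run_rcons /deficit (bigD1 x) //= [ltnRHS](bigD1 x) //=.
rewrite -addSn leq_add ?(def_step_helps Mh w exy hxy) //.
by apply: leq_sum => v _; apply: def_step.
Qed.

Definition sparse (k : nat) h := [forall v, degree h v <= k].

Lemma sparse_rcons k h e : sparse k (rcons h e) -> sparse k h.
Proof.
move=> /forallP H; apply/forallP => v; apply: leq_trans (H v).
by rewrite /degree -cats1 count_cat leq_addr.
Qed.

(** The bounds on poor vertices and on degrees are made part of the unfinished event, so the rate
    holds for every unfinished history and no conditioning occurs. Monotonicity survives: blobs no
    longer change and degrees only grow. *)
Lemma deficient_bound (x : T) (m k t : nat) (B : R) :
    (1 <= B)%R -> n - m - d * L.*2 - k <= N -> M2 <= t <= N ->
  (#|[set p : ordering n | [&& deficient (run (take t p)) x,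
      (#|poor (run (take t p)).2| <= m)%N & sparse k (take t p)]]|%:R <=
    bound (n - m - d * L.*2 - k)%N d B (t - M2)%N)%R.
Proof.
move=> B1 rN tN.
apply: (unfinished_bound (unf := fun h => [&& deficient (run h) x, #|poor (run h).2| <= m & sparse k h])
  (phi := fun h => def (run h) x)) => //.
- move=> h _ _ _; rewrite (leq_trans (leq_subr _ _)) // /req.
  by case: ifP => // _; exact: leq_subr.
- move=> h e uh eh /andP[Mh hM]; have M1h := leq_trans M12 Mh.
  rewrite run_rcons step_blobs // => /and3P[/(deficient_step M1h) -> -> /sparse_rcons ->].
  by split => //; apply: def_step.
move=> h uh /andP[Mh hM] /and3P[dx pm /forallP sk]; have M1h := leq_trans M12 Mh.
have I := inv_run (n := n) d u M1 M2 h L0; rewrite (surjective_pairing (run h)) in I dx.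
apply: leq_trans (_ : n - #|poor (run h).2| - d * L.*2 - k <= _); first by rewrite !leq_sub2r // leq_sub2l.
apply: leq_trans (help_progress I dx (sk x)) _; apply/subset_leq_card/subsetP => e.
rewrite -surjective_pairing !inE => /andP[-> /existsP[[x' y] /= /andP[/eqP exy /andP[/eqP ex hxy]]]].
rewrite {}ex in exy; apply/implyP => _; rewrite run_rcons (def_step_helps M1h _ exy hxy) //.
rewrite /wanted ltnNge Mh /=; apply/existsP; exists (x, y) => /=.
by rewrite exy eqxx hxy.
Qed.

(** A single hook finishes the requirement, so the potential is constantly 0 and no power of [B] is
    lost. *)
Lemma contact_bound (x : T) (j k t : nat) (B : R) :
    (1 <= B)%R -> L * (u./2 - k) <= N -> M2 <= t <= N ->
  (#|[set p : ordering n | [&& good (run (take t p)).2 x, ~~ contact (run (take t p)) x j,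
      [exists b, (cls b == j) && giant (run (take t p)).2 b] & sparse k (take t p)]]|%:R <=
    bound (L * (u./2 - k))%N 0 B (t - M2)%N)%R.
Proof.
move=> B1 rN tN.
apply: (unfinished_bound (unf := fun h => [&& good (run h).2 x, ~~ contact (run h) x j,
      [exists b, (cls b == j) && giant (run h).2 b] & sparse k h])
  (phi := fun h => 0)) => //.
- move=> h e uh eh /andP[Mh hM]; have M1h := leq_trans M12 Mh.
  rewrite run_rcons => H; split => //; move: H.
  have := step_sub d u L M1 M2 (size h) (run h) e.
  have := step_blobs d u L M2 (run h) e M1h.
  case: (step _ _ _) => E' P' /= ->.
  case: (run h) => E P /= sE /and4P[-> nc -> /sparse_rcons ->]; rewrite !andbT.
  by apply: contra nc; apply: contact_sub.
move=> h uh /andP[Mh hM] /and4P[gx nc /existsP[b /andP[/eqP bj gb]] /forallP sk].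
have M1h := leq_trans M12 Mh.
have I := inv_run (n := n) d u M1 M2 h L0; rewrite (surjective_pairing (run h)) in I nc.
rewrite -bj in nc; apply: leq_trans (hook_progress I gx gb nc sk) _.
apply/subset_leq_card/subsetP => e; rewrite -surjective_pairing !inE => /andP[-> /existsP[[x' y]]] /=.
case/and4P => /eqP exy xx yb hxy; apply/implyP; rewrite run_rcons stepE //.
have -> : wanted d u L M2 (size h) (run h) e.
  by rewrite /wanted ltnNge Mh /=; apply/existsP; exists (x', y); rewrite /= exy eqxx hxy orbT.
case/and4P => /= _ /negP[]; apply/existsP; exists (x', y).
have /= yj := inv_cls I yb; rewrite /= xx yj bj eqxx -exy setU11 andbT /=.
by case/and3P: hxy.
Qed.

End Events.

(** * Degree estimate and the capped strategy *)

Section Strategy.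
Import mathcomp.boot.fintype mathcomp.boot.finset mathcomp.boot.fingraph.
Local Open Scope nat_scope.
Local Open Scope set_scope.
Variables (R : realType) (n d u L M1 M2 : nat).
Hypotheses (u0 : 0 < u) (L0 : 0 < L) (M12 : M1 <= M2).
Local Notation T := 'I_n.
Local Notation N := 'C(n, 2).
Local Notation blobs := {ffun T -> seq T}.
Local Notation state := ({set {set T}} * blobs)%type.
Local Notation cls := (@cls n d u).
Local Notation good := (@good n d u L).
Local Notation deficient := (@deficient n d u L).
Local Notation contact := (@contact n d u).
Local Notation lacking := (@lacking n d u L).
Local Notation poor := (@poor n d u L).
Local Notation run := (@run n d u L M1 M2).
Local Notation step := (@step n d u L M1 M2).
Local Notation needy := (@needy n d u L M1 M2).
Implicit Types (st : state) (P : blobs) (v w x y : T) (p : ordering n).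
Implicit Types (h : seq (edge n)) (e : edge n).

Lemma card_star v : #|[set e : edge n | v \in edge_set e]| <= n.
Proof.
rewrite -(card_imset _ (@edge_set_inj n)) -[leqRHS]card_ord.
apply: leq_trans (leq_imset_card (fun w => [set v; w]) T).
apply/subset_leq_card/subsetP => _ /imsetP[e + ->]; rewrite inE => ve.
have /cards2P[a [b [ab eab]]] := card_edge_set e.
move: ve; rewrite eab !inE => /orP[]/eqP->; apply/imsetP.
  by exists b.
by exists a => //; rewrite setUC.
Qed.

(** Markov's inequality for [2 ^ degree]: at most [n] of at least [N - s] unseen edges contain [v],
    so one round multiplies the mean by at most [1 + n / (N - s)]. *)
Lemma degree_bound v (k s : nat) : s < N ->
  (#|[set p : ordering n | (k < degree (take s p) v)%N]|%:R <=
   #|{: ordering n}|%:R * ((1 + n%:R / (N - s)%:R) ^+ s / 2 ^+ k) :> R)%R.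
Proof.
move=> sN; have Ns : (0 < (N - s)%:R :> R)%R by rewrite ltr0n subn_gt0.
pose X h : R := (2 ^+ degree h v)%R.
have X0 h : (0 < X h)%R by rewrite exprn_gt0.
set c := (1 + _)%R; have c0 : (0 <= c)%R by rewrite addr_ge0 // divr_ge0.
have := @supermartingale R n X c 0 s c0; rewrite leq0n subn0 (ltnW sN) => /(_ isT).
have -> : (\sum_(p : ordering n) X (take 0 p) = #|{: ordering n}|%:R)%R.
  by rewrite (eq_bigr (fun=> 1%R)) ?sumr_const // => p _; rewrite /X take0.
move=> XM; rewrite mulrA ler_pdivlMr ?exprn_gt0 // mulrC [leRHS]mulrC.
apply: (@le_trans _ _ (\sum_(p : ordering n) X (take s p))%R); last apply: XM.
  rewrite mulrC -sum1_card natr_sum mulr_suml big_mkcond /=; apply: ler_sum => p _.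
  by rewrite inE mul1r; case: ifP => [/ltnW kd|_]; [rewrite ler_weXn2l // ler1n | apply: ltW].
move=> h uh /andP[_ hs].
pose W := [set e | (e \notin h) && (v \in edge_set e)].
have XE e : X (rcons h e) = (X h * (1 + (v \in edge_set e)%:R))%R.
  rewrite /X /degree -cats1 count_cat /= addn0 exprD.
  by case: (v \in _) => /=; rewrite ?expr1 ?expr0 ?addr0.
under eq_bigr do rewrite XE.
rewrite -mulr_sumr [(c * _)%R]mulrC -mulrnAr; apply: ler_wpM2l; first exact: ltW.
have cN : #|(fun e => e \notin h)| = N - size h.
  by rewrite -card_edge -(cardC (mem h)) (card_uniqP uh) addKn.
rewrite big_split /= sumr_const cN -[leRHS]mulr_natr /c mulrDl mul1r lerD //.
apply: (@le_trans _ _ n%:R).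
  rewrite -natr_sum ler_nat; apply: leq_trans (card_star v).
  rewrite -sum1_card [leqLHS]big_mkcond [leqRHS]big_mkcond; apply: leq_sum => e _.
  by rewrite inE; case: (e \notin h) => //=; case: (v \in _).
by rewrite mulrAC ler_pdivlMr // ler_wpM2l // ler_nat leq_sub2l // ltnW.
Qed.

(** The state is recomputed from the proposed edges and follows the uncapped process; the cap only
    suppresses acceptances. So the graph built is always a subgraph of that of [run]. *)
Definition capped (b : R) : strategy n := [ffun h : history n =>
  if rev h is e :: _ then (edge_set e \in (run h).1) && (#|(run h).1|%:R <= b)%R
  else false].

Lemma capped_proposed b p (i : 'I_N) : capped b (proposed p i.+1) =
  (edge_set (tnth p i) \in (run (take i.+1 p)).1) && (#|(run (take i.+1 p)).1|%:R <= b)%R.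
Proof. by rewrite ffunE /= take_rcons_tnth rev_rcons. Qed.

Lemma graph_at_sub b p s : graph_at (capped b) p s \subset (run (take s p)).1.
Proof.
apply/subsetP => _ /imsetP[i + ->]; rewrite inE capped_proposed => /and3P[si ie _].
have := run_sub d u L M1 M2 (take s p) i.+1; rewrite take_takel // => /subsetP; exact.
Qed.

Lemma graph_at_le b p s : (0 <= b)%R -> (#|graph_at (capped b) p s|%:R <= b)%R.
Proof.
move=> b0; elim: s => [|s IH].
  suff -> : graph_at (capped b) p 0 = set0 by rewrite cards0.
  by apply/setP => A; rewrite !inE; apply/imsetP => -[i]; rewrite inE.
have [/existsP[i /andP[/eqP iE ci]]|] := boolP [exists i : 'I_N, (i == s :> nat) && capped b (proposed p i.+1)].
  move: ci; rewrite capped_proposed iE => /andP[_]; apply: le_trans.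
  by rewrite ler_nat subset_leq_card // graph_at_sub.
move=> /existsPn nc; apply: le_trans IH; rewrite ler_nat.
apply/subset_leq_card/subsetP => _ /imsetP[i + ->]; rewrite inE ltnS leq_eqVlt => /andP[/orP[iE|lt] ci].
  by have := nc i; rewrite iE ci.
by apply/imsetP; exists i; rewrite // inE lt ci.
Qed.

Lemma run_mem p s A : s <= N -> A \in (run (take s p)).1 ->
  exists i : 'I_N, [/\ i < s, A = edge_set (tnth p i) & A \in (run (take i.+1 p)).1].
Proof.
elim: s => [|s IH] sN; first by rewrite take0 inE.
have {}IH := IH (ltnW sN); set i := Ordinal sN.
move=> As; have := As; rewrite -[s]/(nat_of_ord i) take_rcons_tnth run_rcons => Ai.
have [/IH[k [ks -> ?]]|nA] := boolP (A \in (run (take s p)).1).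
  by exists k; split => //; apply: ltnW.
exists i; split => //; move: Ai nA; rewrite /step -[nat_of_ord i]/s; case: ifP => _.
  have [-> -> //|[x [y [-> _ ->]]]] := growP d u L (run (take s p)) (tnth p i).
  by rewrite !inE => /orP[/eqP //|->].
by case: ifP => _; [rewrite in_setU1 => /orP[/eqP //|->] | move=> ->].
Qed.

(** The edge set of [run] only grows, so a final size within [b] means that the cap never acted. *)
Lemma graph_at_run b p s : s <= N -> (#|(run (take s p)).1|%:R <= b)%R ->
  graph_at (capped b) p s = (run (take s p)).1.
Proof.
move=> sN le; apply/eqP; rewrite eqEsubset graph_at_sub /=; apply/subsetP => A.
move=> /(run_mem sN)[i [iE AE Ai]]; apply/imsetP; exists i => //.
rewrite inE iE capped_proposed -AE Ai; apply: le_trans le; rewrite ler_nat.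
apply/subset_leq_card; have := run_sub d u L M1 M2 (take s p) i.+1.
by rewrite take_takel.
Qed.

Lemma poor_le P : ~~ lacking P -> #|poor P| <= d * u + u.
Proof.
rewrite negb_or -leqNgt => /andP[small _].
apply: leq_trans (_ : #|(\bigcup_(j in [set: 'I_d]) [set v | cls v == j]) :|:
   [set v | (cls v == d) && (size (P v) < L)]| <= _).
  apply/subset_leq_card/subsetP => v; rewrite !inE /good negb_and -ltnNge.
  case: (eqVneq (cls v) d) => /= [_ ->|vd _]; first by rewrite orbT.
  rewrite orbF.
  have lt : cls v < d by rewrite ltn_neqAle vd /cls geq_minr.
  by apply/bigcupP; exists (Ordinal lt); rewrite ?inE.
apply: leq_trans (leq_card_setU _ _) _; apply: leq_add => //.
rewrite -[X in X * _]card_ord -cardsT; apply: card_bigcup_le => j _.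
exact: card_cls.
Qed.

Lemma outcome p t : 2 <= d -> d < n -> M2 <= t <= N ->
    ~~ lacking (run (take M1 p)).2 -> #|needy (take M2 p)| <= u ->
    (forall x, ~~ deficient (run (take t p)) x) ->
    (forall x (j : 'I_d), good (run (take t p)).2 x -> contact (run (take t p)) x j) ->
  d_connected (run (take t p)).1 d /\
  2 * #|(run (take t p)).1| <=
    d * n + (d + 2) * (d * u + u) + (2 * d + 4) * (n %/ L) + d * u.
Proof.
move=> d2 dn /andP[Mt tN] nl nd ndef cont.
have st : size (take t p) = t by rewrite size_take_min size_tuple (minn_idPl tN).
have M1t := leq_trans M12 Mt.
have I := inv_run (n := n) d u M1 M2 (take t p) L0.
have PE : (run (take t p)).2 = (run (take M1 p)).2.
  have := run_blobs d u L M2 (h := take t p) (leqnn M1).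
  by rewrite st take_takel //; apply.
split.
  apply: (process_connected u0 dn I) => [j jd|v|v j gv jd].
  - move: nl; rewrite -PE negb_or => /andP[_ /existsPn/(_ (Ordinal jd))].
    by rewrite negb_forall => /existsP[b]; rewrite negb_imply negbK => /andP[/eqP ? ?]; exists b.
  - by rewrite leqNgt; apply: ndef.
  - exact: (cont v (Ordinal jd)).
have := @edges_bound n d u L M1 M2 (take t p) L0 d2.
rewrite st M12 Mt => /(_ isT) /leq_trans; apply.
rewrite take_takel //; apply: leq_add; last first.
  rewrite leq_mul2l; apply/orP; right; apply: leq_trans nd.
  apply/subset_leq_card/subsetP => v; rewrite !inE.
  have := run_blobs d u L M2 (h := take t p) M12.
  by rewrite st take_takel // => ->.
apply: leq_add; first by rewrite leq_add2l leq_mul2l PE poor_le // orbT.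
rewrite leq_mul2l leq_divRL //; apply/orP; right.
by apply: (@card_tails n d u L (run (take t p)).1); rewrite -surjective_pairing.
Qed.

End Strategy.

(** * Union bound over the bad events *)

Section Failure.
Import mathcomp.boot.fintype mathcomp.boot.finset mathcomp.boot.fingraph.
Local Open Scope nat_scope.
Local Open Scope set_scope.
Variables (R : realType) (n d u L M1 M2 : nat).
Hypotheses (u0 : 0 < u) (L0 : 0 < L) (M12 : M1 <= M2).
Local Notation N := 'C(n, 2).
Local Notation bound r K B s := (B ^+ K * (1 - r%:R / N%:R * (1 - B^-1)) ^+ s)%R.

Lemma card_bigcup_sum (I T : finType) (F : I -> {set T}) :
  #|\bigcup_i F i| <= \sum_i #|F i|.
Proof.
elim/big_rec2: _ => [|i m A _ le]; first by rewrite cards0.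
by apply: leq_trans (leq_card_setU _ _) _; rewrite leq_add2l.
Qed.

Lemma natr_sum_le (m : nat) (f : 'I_m -> nat) (c : R) :
  (forall x, (f x)%:R <= c)%R -> ((\sum_x f x)%:R <= m%:R * c)%R.
Proof.
move=> fc; rewrite natr_sum -[m in leRHS]card_ord mulr_natl -sumr_const.
by apply: ler_sum => x _; exact: fc.
Qed.

(** The summands stand, in this order, for an incomplete blob structure, too many needy vertices
    after the mutual phase, a deficient vertex, a missing contact, and a vertex of large degree. *)
Lemma failure_bound (b B : R) (t k r1 r2 : nat) :
    2 <= d -> d < n -> d * u <= n -> M2 <= t -> t < N -> (1 <= B)%R ->
    r1 <= N -> 4 * (r1 + M1) <= u %/ L * (u %/ L - 1) ->
    r2 <= N -> 2 * (r2 + M2) <= u * (u - d * (4 * L)) ->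
    n - (d * u + u) - d * L.*2 - k <= N -> L * (u./2 - k) <= N ->
    ((d * n + (d + 2) * (d * u + u) + (2 * d + 4) * (n %/ L) + d * u)%:R <= 2 * b)%R ->
  (#|[set p : ordering n | ~~ d_connected (graph_at (capped n d u L M1 M2 b) p t) d]|%:R <=
   #|{: ordering n}|%:R * (bound r1 n (2%:R : R) M1 + bound r2 (d * n)%N 2%:R (M2 - M1)%N +
     n%:R * bound (n - (d * u + u) - d * L.*2 - k)%N d B (t - M2)%N +
     n%:R * d%:R * bound (L * (u./2 - k))%N 0 B (t - M2)%N +
     n%:R * ((1 + n%:R / (N - t)%:R) ^+ t / 2 ^+ k)))%R.
Proof.
move=> d2 dn dun Mt tN B1 r1N r1M r2N r2M r3N r4N bb.
have MN := leq_trans Mt (ltnW tN).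
have MtN : M2 <= t <= N by rewrite Mt ltnW.
pose st s (p : ordering n) := run d u L M1 M2 (take s p).
pose A1 := [set p : ordering n | lacking d u L (st M1 p).2].
pose A2 := [set p : ordering n | u < #|needy d u L M1 M2 (take M2 p)|].
pose A3 x := [set p : ordering n | [&& deficient d u L (st t p) x,
  #|poor d u L (st t p).2| <= d * u + u & sparse k (take t p)]].
pose A4 x (j : 'I_d) := [set p : ordering n | [&& good d u L (st t p).2 x,
  ~~ contact d u (st t p) x j,
  [exists b, (cls d u b == j) && giant d u (st t p).2 b] & sparse k (take t p)]].
pose A5 x := [set p : ordering n | k < degree (take t p) x].
set fail := [set p | _].
have sub : fail \subset A1 :|: A2 :|: \bigcup_x A3 x :|: \bigcup_x \bigcup_j A4 x j :|: \bigcup_x A5 x.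
  apply/subsetP => p; rewrite inE; apply: contraR.
  rewrite !in_setU !negb_or -!andbA => /and5P[n1 n2 n3 n4 n5].
  have nl : ~~ lacking d u L (run d u L M1 M2 (take M1 p)).2 by move: n1; rewrite inE.
  have sp : sparse k (take t p).
    apply/forallP => v; rewrite leqNgt; apply: contra n5 => kv.
    by apply/bigcupP; exists v; rewrite ?inE.
  have size_t : size (take t p) = t by rewrite size_take_min size_tuple (minn_idPl (ltnW tN)).
  have PE : (st t p).2 = (st M1 p).2.
    have := run_blobs d u L M2 (h := take t p) (leqnn M1).
    by rewrite size_t take_takel ?(leq_trans M12) //; apply.
  have nd : #|needy d u L M1 M2 (take M2 p)| <= u by move: n2; rewrite inE -leqNgt.
  have ndef x : ~~ deficient d u L (st t p) x.
    apply: contra n3 => dx; apply/bigcupP; exists x => //; rewrite inE dx sp andbT /=.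
    by rewrite PE poor_le.
  have cont x (j : 'I_d) : good d u L (st t p).2 x -> contact d u (st t p) x j.
    move=> gx; apply: contraR n4 => nc; apply/bigcupP; exists x => //; apply/bigcupP; exists j => //.
    rewrite inE gx nc sp andbT /= PE.
    move: nl; rewrite negb_or => /andP[_ /existsPn/(_ j)].
    rewrite negb_forall => /existsP[a]; rewrite negb_imply negbK => /andP[aj ga].
    by apply/existsP; exists a; rewrite aj.
  have [conn le] := outcome u0 L0 M12 d2 dn MtN nl nd ndef cont.
  rewrite (graph_at_run (ltnW tN)) //; rewrite -(ler_pM2l (ltr0Sn R 1)).
  by apply: le_trans bb; rewrite -natrM ler_nat.
apply: (@le_trans _ _ (#|A1| + #|A2| + \sum_x #|A3 x| + \sum_x \sum_j #|A4 x j| + \sum_x #|A5 x|)%:R).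
  rewrite ler_nat; apply: leq_trans (subset_leq_card sub) _.
  apply: leq_trans (leq_card_setU _ _) _; apply: leq_add; last exact: card_bigcup_sum.
  apply: leq_trans (leq_card_setU _ _) _; apply: leq_add; last first.
    apply: leq_trans (card_bigcup_sum _) _; apply: leq_sum => x _.
    exact: card_bigcup_sum.
  apply: leq_trans (leq_card_setU _ _) _; apply: leq_add; last exact: card_bigcup_sum.
  exact: leq_card_setU.
rewrite !natrD 4!(mulrDr #|{: ordering n}|%:R%R); do !apply: lerD.
- by apply: lacking_bound => //; apply: leq_trans MN.
- exact: needy_bound.
- rewrite mulrCA; apply: natr_sum_le => x; exact: deficient_bound.
- rewrite -mulrA mulrCA; apply: natr_sum_le => x.
  rewrite mulrCA; apply: natr_sum_le => j; exact: contact_bound.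
- rewrite mulrCA; apply: natr_sum_le => x; exact: degree_bound.
Qed.

End Failure.

(** * Exponential estimates *)

Section Numerics.
Variable R : realType.
Implicit Types (x y a l delta B : R) (n m r N : nat).

Lemma one_sub_exp y m : 0 <= y <= 1 -> (1 - y) ^+ m <= expR (- (y * m%:R)).
Proof.
move=> /andP[y0 y1]; have -> : - (y * m%:R) = m%:R * - y by rewrite mulrN mulrC.
rewrite expRM_natl; apply: lerXn2r; rewrite ?nnegrE ?subr_ge0 ?expR_ge0 //.
by apply: le_trans (expR_ge1Dx _); rewrite lerD2l.
Qed.

Lemma one_add_exp y m : 0 <= y -> (1 + y) ^+ m <= expR (y * m%:R).
Proof.
move=> y0; rewrite mulrC expRM_natl; apply: lerXn2r.
- by rewrite nnegrE addr_ge0.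
- by rewrite nnegrE expR_ge0.
- exact: expR_ge1Dx.
Qed.

Lemma hitting_time_bound r N m B y : (r <= N)%N -> 1 <= B ->
    y <= r%:R / N%:R * (1 - B^-1) * m%:R ->
  (1 - r%:R / N%:R * (1 - B^-1)) ^+ m <= expR (- y).
Proof.
move=> rN B1 yr.
have iB : 0 <= B^-1 <= 1 by rewrite invr_ge0 (le_trans ler01 B1) invf_le1 ?(lt_le_trans ltr01 B1).
apply: le_trans (one_sub_exp _ _) _; last by rewrite ler_expR lerN2.
have r0 : 0 <= r%:R / N%:R :> R by rewrite divr_ge0.
have r1 : r%:R / N%:R <= 1 :> R.
  have [->|N0] := posnP N; first by rewrite invr0 mulr0.
  by rewrite ler_pdivrMr ?ltr0n // mul1r ler_nat.
have /andP[i0 i1] := iB; have B2 : 0 <= 1 - B^-1 by rewrite subr_ge0.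
by rewrite mulr_ge0 // mulr_ile1 // lerBlDr lerDl.
Qed.

Lemma bin2_natr n : ('C(n, 2)%:R : R) = n%:R * (n%:R - 1) / 2.
Proof.
case: n => [|n]; first by rewrite mul0r mul0r.
have : ('C(n.+1, 2) * 2 = n.+1 * n)%N.
  by rewrite bin2 /= muln2 halfK oddM /= andNb subn0.
move=> /(congr1 (fun m => m%:R : R)); rewrite !natrM => E.
have -> : n.+1%:R - 1 = n%:R :> R by rewrite -natr1 addrK.
by rewrite -E mulfK.
Qed.

Lemma ge_expR_sqr l : 0 <= l -> l * l / 4 <= expR l.
Proof.
move=> l0; pose m := l / 2; have lm : l = m + m by rewrite /m; lra.
have m0 : 0 <= m by rewrite /m; lra.
rewrite lm expRD; have zm := expR_ge1Dx m; move: (expR m) zm => z zm.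
have : m * m <= z * z by apply: ler_pM => //; lra.
lra.
Qed.

(* Rate times duration in the final phase: the factors are [r / N], [1 - 1 / B]
   with [B = 16 / delta], and the number of rounds. *)
Lemma final_phase_rate x l delta (r N m : R) : 0 < delta <= 1 -> 0 < x -> 0 <= l ->
    0 < N -> N <= x * x / 2 -> (1 - delta / 16) * x <= r ->
    (1 + delta / 2) * (x * l / 2) <= m ->
  (1 + delta / 4) * l <= r / N * (1 - (16 / delta)^-1) * m.
Proof.
move=> /andP[de0 de1] x0 l0 N0 Nx rx mx.
have -> : (16 / delta)^-1 = delta / 16 by rewrite invf_div.
set c := 1 - delta / 16 in rx *; have c0 : 0 < c by rewrite /c; lra.
have rN : c * 2 / x <= r / N.
  rewrite ler_pdivlMr // mulrAC ler_pdivrMr //.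
  have := ler_wpM2r (ltW x0) rx.
  have : c * 2 * N <= c * 2 * (x * x / 2) by rewrite ler_wpM2l // mulr_ge0 // ltW.
  nra.
have k0 : 0 <= (1 + delta / 2) * (x * l / 2).
  by apply: mulr_ge0; [lra | apply: mulr_ge0 => //; apply: mulr_ge0 => //; exact: ltW].
apply: (@le_trans _ _ (c * 2 / x * c * ((1 + delta / 2) * (x * l / 2)))); last first.
  have c1 := ltW c0; have x1 := ltW x0.
  apply: ler_pM => //; first by apply: mulr_ge0 => //; apply: mulr_ge0; rewrite ?invr_ge0 // mulr_ge0.
  by apply: ler_wpM2r => //; exact: ltW.
have -> : c * 2 / x * c * ((1 + delta / 2) * (x * l / 2)) = c * c * (1 + delta / 2) * l.
  by field; exact: lt0r_neq0.
(* One factor [c] is lost in the rate and one in [1 - 1 / B]; for [delta <= 1] the product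
   [(1 - delta / 16) ^ 2 * (1 + delta / 2)] is still at least [1 + delta / 4]. *)
apply: ler_wpM2r => //; rewrite /c; nra.
Qed.

(** With base 2 the potential contributes at most [2 ^ (d n)]. A constant rate over order [n log n]
    rounds yields any multiple of [n] in the exponent; [d + 1] leaves a factor [expR (- n)] to
    spare. *)
Lemma early_phase_rate x l delta c (r N m : R) (d : R) : 0 < x -> 0 <= d ->
    0 < delta -> 0 < N -> N <= x * x / 2 -> 0 < c ->
    c * (x * x) <= r -> delta / 32 * (x * l) <= m -> 32 * (d + 1) <= c * delta * l ->
  (d + 1) * x <= r / N * (1 - 2^-1) * m.
Proof.
move=> x0 d0 de0 N0 Nx c0 rx mx cl.
have l0 : 0 <= l.
  rewrite -(pmulr_rge0 _ (mulr_gt0 c0 de0)); apply: le_trans cl; lra.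
have rN : 2 * c <= r / N.
  rewrite ler_pdivlMr //; apply: le_trans rx.
  have : 2 * c * N <= 2 * c * (x * x / 2) by rewrite ler_wpM2l // mulr_ge0 // ltW.
  nra.
apply: (@le_trans _ _ (2 * c * (1 - 2^-1) * (delta / 32 * (x * l)))); last first.
  apply: ler_pM => //.
  - by apply: mulr_ge0; lra.
  - by apply: mulr_ge0; [lra | apply: mulr_ge0 => //; apply: ltW].
  - by apply: ler_wpM2r => //; lra.
have -> : 2 * c * (1 - 2^-1) * (delta / 32 * (x * l)) = (c * delta * l / 32) * x by field.
by apply: ler_wpM2r; [exact: ltW | lra].
Qed.

End Numerics.

Lemma rate_le_of_quarter (r m y z : nat) : (4 * (r + m) <= y -> y <= 2 * z -> r <= z)%N.
Proof. lia. Qed.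

Lemma rate_le_of_half (r m y z : nat) : (2 * (r + m) <= y -> y <= 2 * z -> r <= z)%N.
Proof. lia. Qed.

(** * Parameters for a fixed [delta] *)

Section ParameterChoice.
Variables (R : realType) (d n A L u k q M1 t N r1 r2 r3 r4 : nat).
Variables (delta D a x l c b B tau : R).
Hypotheses (DE : d%:R = D) (aE : A%:R = a) (xE : n%:R = x) (lE : expR l = x).
Hypotheses (LE : L = (8 * A)%N) (uE : u = (n %/ A)%N) (kE : k = (u %/ 4)%N).
Hypotheses (qE : q = (u %/ L)%N) (NE : N = 'C(n, 2)).
Hypothesis M1E : M1 = Num.truncn (delta / 16 * (x * l)).
Hypothesis tE : t = Num.truncn ((1 + delta) * (x * l / 2)).
Hypothesis r1E : r1 = ((q * (q - 1)) %/ 4 - M1)%N.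
Hypothesis r2E : r2 = ((u * (u - d * (4 * L))) %/ 2 - M1.*2)%N.
Hypothesis r3E : r3 = (n - (d * u + u) - d * L.*2 - k)%N.
Hypothesis r4E : r4 = (L * (u./2 - k))%N.
(* [c * n ^ 2] is a lower bound for the number of useful edges in the first two phases. *)
Hypothesis cE : 2048 * (a * a * (a * a)) * c = 1.
Hypotheses (bE : b = (1 + delta) * (D * x / 2)) (BE : B = 16 / delta).
Hypothesis tauE : tau = expR (- (delta / 4 * l)).
Hypotheses (d2 : (2 <= d)%N) (delta01 : 0 < delta <= 1).
Hypothesis A_large : 16 * (D + 2) + (D + 2) * (D + 1) + 3 * D + 4 <= delta * a.
Hypothesis n_large0 : 100 * D * (a * a) <= x.
Hypothesis n_large1 : l <= c * x.
Hypothesis n_large2 : 32 * (D + 1) <= c * (delta * l).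

Lemma D_ge2 : 2 <= D. Proof. by rewrite -DE ler_nat. Qed.

Lemma a_ge64 : 64 <= a.
Proof.
have := D_ge2; have /andP[d0 d1] := delta01; move: A_large.
have a0 : 0 <= a by rewrite -aE ler0n.
have : delta * a <= a by rewrite ler_piMl.
move: D a a0 => y z; nra.
Qed.

Lemma A_gt0 : (0 < A)%N.
Proof. by rewrite -(ltr_nat R) aE; have := a_ge64; lra. Qed.

Lemma aa_ge1 : 1 <= a * a.
Proof. by have := a_ge64; nra. Qed.

Lemma aaaa_ge1 : 1 <= a * a * (a * a).
Proof. by have := aa_ge1; nra. Qed.

Lemma c_gt0 : 0 < c.
Proof.
have a4 : 0 < 2048 * (a * a * (a * a)) by have := aaaa_ge1; lra.
by rewrite -(pmulr_rgt0 _ a4) cE.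
Qed.

Lemma c_le : 2048 * c <= 1.
Proof.
rewrite -[leRHS]cE; have : c <= a * a * (a * a) * c; last lra.
by rewrite ler_peMl ?aaaa_ge1 // ltW // c_gt0.
Qed.

Lemma deltal_ge : 96 <= delta * l.
Proof.
have c0 := c_gt0; have h : 96 <= c * (delta * l).
  by apply: le_trans n_large2; have := D_ge2; lra.
have dl0 : 0 <= delta * l by rewrite -(pmulr_rge0 _ c0); lra.
by apply: (le_trans h); rewrite ler_piMl //; have := c_le; lra.
Qed.

Lemma l_ge96 : 96 <= l.
Proof.
have /andP[d0 d1] := delta01; have dl := deltal_ge.
have l0 : 0 <= l by rewrite -(pmulr_rge0 _ d0); lra.
by apply: le_trans dl _; rewrite ler_piMl.
Qed.

Lemma x_ge : 200 * (a * a) <= x.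
Proof. by apply: le_trans n_large0; have := D_ge2; have := aa_ge1; nra. Qed.

Lemma x_gt0 : 0 < x.
Proof. by have := x_ge; have := aa_ge1; lra. Qed.

Lemma l_le : 2048 * l <= x.
Proof.
have : 2048 * c * x <= 1 * x by apply: ler_wpM2r c_le; exact/ltW/x_gt0.
by have := n_large1; lra.
Qed.

Lemma u_bounds : u%:R * a <= x /\ x < (u%:R + 1) * a.
Proof.
rewrite -aE -xE natr1 -!natrM ler_nat ltr_nat uE leq_divM; split => //.
exact/ltn_ceil/A_gt0.
Qed.

Lemma L_gt0 : (0 < L)%N. Proof. by rewrite LE muln_gt0 A_gt0. Qed.

Lemma q_bounds : u%:R < (q%:R + 1) * (8 * a).
Proof.
by rewrite -aE natr1 -!natrM ltr_nat -LE qE; apply/ltn_ceil/L_gt0.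
Qed.

Lemma k_bounds : 4 * k%:R <= u%:R :> R /\ u%:R < 4 * k%:R + 4 :> R.
Proof.
have := leq_divM u 4; have := ltn_ceil u (isT : 0 < 4)%N.
rewrite -kE -(ltr_nat R) -(ler_nat R) !natrM -natr1 => h1 h2; split; lra.
Qed.

Lemma xl_gt0 : 0 < x * l.
Proof. by apply: mulr_gt0; [exact: x_gt0 | have := l_ge96; lra]. Qed.

Lemma x_ge1 : 1 <= x.
Proof. by have := x_ge; have := aa_ge1; lra. Qed.

Lemma deltaxl_ge : 96 <= delta * (x * l).
Proof.
rewrite mulrCA; have dl := deltal_ge; apply: (le_trans dl).
by rewrite ler_peMl ?x_ge1 //; lra.
Qed.

Lemma M1_bounds : M1%:R <= delta / 16 * (x * l) /\ delta / 32 * (x * l) <= M1%:R.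
Proof.
have /andP[d0 d1] := delta01; have xl0 := xl_gt0.
have y0 : 0 <= delta / 16 * (x * l) by apply: mulr_ge0; [lra | exact: ltW].
have /andP[h1 h2] := truncn_itv y0; rewrite -M1E in h1; split => //.
have := deltaxl_ge.
have h3 : M1.+1%:R = M1%:R + 1 :> R by rewrite natr1.
by rewrite -M1E h3 in h2; lra.
Qed.

Lemma t_bounds : t%:R <= (1 + delta) * (x * l / 2) /\ (1 + delta) * (x * l / 2) < t%:R + 1.
Proof.
have /andP[d0 d1] := delta01; have xl0 := xl_gt0.
have y0 : 0 <= (1 + delta) * (x * l / 2) by apply: mulr_ge0; lra.
by have /andP[h1 h2] := truncn_itv y0; rewrite natr1 tE.
Qed.

(** The two early phases use at most [delta / 4] of the surplus [delta], and another [delta / 4]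
    absorbs the rounding of [t]. *)
Lemma phase3_length : (1 + delta / 2) * (x * l / 2) <= t%:R - (M1.*2)%:R.
Proof.
have [_ h1] := t_bounds; have [h2 _] := M1_bounds; have := deltaxl_ge.
rewrite -muln2 natrM; lra.
Qed.

Lemma M2_le_t : (M1.*2 <= t)%N.
Proof.
rewrite -(ler_nat R) -subr_ge0; apply: le_trans phase3_length.
by have /andP[d0 d1] := delta01; have := xl_gt0; nra.
Qed.

Lemma N_eq : N%:R = x * (x - 1) / 2.
Proof. by rewrite NE bin2_natr xE. Qed.

Lemma t_le : t%:R <= x * l.
Proof.
have [h1 _] := t_bounds; have /andP[d0 d1] := delta01; have := xl_gt0; nra.
Qed.

Lemma N_sub_t : x * x / 4 <= N%:R - t%:R.
Proof.
rewrite N_eq; have := t_le; have := l_le; have := x_gt0; have := l_ge96.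
move: t%:R l x => T y z; nra.
Qed.

Lemma t_lt_N : (t < N)%N.
Proof.
rewrite -(ltr_nat R) -subr_gt0; apply: lt_le_trans N_sub_t.
by have := x_gt0; nra.
Qed.

Lemma natrB_lower (i j : nat) : i%:R - j%:R <= (i - j)%:R :> R.
Proof.
have [ij|/ltnW ij] := leqP j i; first by rewrite natrB.
by rewrite (eqP ij) subr_le0 ler_nat.
Qed.

Lemma divn_ge (i m : nat) : (0 < m)%N -> i%:R / m%:R - 1 <= (i %/ m)%:R :> R.
Proof.
move=> m0; rewrite lerBlDr ler_pdivrMr ?ltr0n // natr1 -natrM ler_nat.
exact/ltnW/ltn_ceil.
Qed.

Lemma c_mul_le (y z : R) : y <= 2048 * (a * a * (a * a)) * z -> c * y <= z.
Proof. by move=> /(ler_wpM2l (ltW c_gt0)); rewrite [leRHS]mulrA [c * (_ * _)]mulrC cE mul1r. Qed.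

(** [q] is about [x / (8 a ^ 2)], so [q - 1] is at least [x / (16 a ^ 2)]; the square of this is
    [x ^ 2 / (256 a ^ 4)], which explains 2048 in [cE]. *)
Lemma q_sqr : 8 * c * (x * x) <= (q * (q - 1))%:R.
Proof.
have [_ ub] := u_bounds; have qb := q_bounds; have xg := x_ge; have ag := a_ge64.
have h : x <= 16 * (a * a) * (q%:R - 1) by nra.
have q1 : (1 <= q)%N.
  rewrite -(ler_nat R) leNgt; apply/negP => q0.
  have := x_gt0; have := aa_ge1; nra.
rewrite natrM natrB // [8 * c]mulrC -mulrA; apply: c_mul_le.
have : x * x <= 16 * (a * a) * (q%:R - 1) * (16 * (a * a) * (q%:R - 1)).
  by apply: ler_pM => //; apply/ltW/x_gt0.
have : (q%:R - 1 : R) * (q%:R - 1) <= q%:R * (q%:R - 1).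
  by apply: ler_wpM2r; [rewrite subr_ge0 ler1n | lra].
have a4 : 0 <= a * a * (a * a) by have := aaaa_ge1; lra.
by move=> /(ler_wpM2l a4); lra.
Qed.

(** The loss allowed in [r1] and [r2]: 2 for rounding, and the rest for the at most [2 M1] edges
    already proposed. *)
Lemma two_plus_le : 2 + delta / 8 * (x * l) <= c * (x * x).
Proof.
have /andP[d0 d1] := delta01.
have xl : x * l <= c * (x * x).
  by rewrite mulrCA; apply: ler_wpM2l; [exact/ltW/x_gt0 | exact: n_large1].
have := deltaxl_ge; have := xl_gt0; move: xl; move: (x * l) (c * _) => y z; nra.
Qed.

Lemma r1_ge : c * (x * x) <= r1%:R.
Proof.
rewrite r1E; apply: le_trans (natrB_lower _ _); have [h1 _] := M1_bounds.
have := @divn_ge (q * (q - 1)) 4 isT; have := q_sqr; have := two_plus_le.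
have := deltaxl_ge; move: (_ %/ _)%:R => z; lra.
Qed.

Lemma r1_M1 : (4 * (r1 + M1) <= q * (q - 1))%N.
Proof.
rewrite r1E subnK; first by rewrite mulnC leq_divM.
rewrite -(ler_nat R); have [h1 _] := M1_bounds.
have := @divn_ge (q * (q - 1)) 4 isT; have := q_sqr; have := two_plus_le.
have := deltaxl_ge; move: (_ %/ _)%:R => z; lra.
Qed.

Lemma u_sqr : 4 * c * (x * x) <= (u * (u - d * (4 * L)))%:R.
Proof.
have [_ ub] := u_bounds; have xg := x_ge; have ag := a_ge64; have Dg := D_ge2.
have h1 : x <= 2 * a * u%:R by nra.
have h2 : x <= 2 * a * (u%:R - D * (32 * a)) by move: n_large0; nra.
have := natrB_lower u (d * (4 * L)).
have -> : (d * (4 * L))%:R = D * (32 * a) by rewrite LE !natrM DE aE; lra.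
rewrite natrM; move: (u - _)%:R => v hv.
have h3 : x <= 2 * a * v by apply: le_trans h2 _; rewrite ler_wpM2l //; lra.
have h4 : x * x <= 2 * a * u%:R * (2 * a * v).
  by apply: ler_pM => //; apply/ltW/x_gt0.
rewrite [4 * c]mulrC -mulrA; apply: c_mul_le.
have a2 := aa_ge1.
have v0 : 0 <= u%:R * v.
  have a2' : 0 < 4 * (a * a) by lra.
  by rewrite -(pmulr_rge0 _ a2'); have := mulr_ge0 (ltW x_gt0) (ltW x_gt0); lra.
have : a * a <= a * a * (a * a) by rewrite ler_peMl //; lra.
have p : 0 <= a * a * (a * a) * (u%:R * v).
  by apply: mulr_ge0 => //; have := aaaa_ge1; lra.
by move=> /(ler_wpM2r v0); lra.
Qed.

Lemma r2_ge : c * (x * x) <= r2%:R.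
Proof.
rewrite r2E; apply: le_trans (natrB_lower _ _); have [h1 _] := M1_bounds.
have := @divn_ge (u * (u - d * (4 * L))) 2 isT; have := u_sqr; have := two_plus_le.
have := deltaxl_ge; rewrite -muln2 [(M1 * 2)%:R]natrM; move: (_ %/ _)%:R => z; lra.
Qed.

Lemma r2_M2 : (2 * (r2 + M1.*2) <= u * (u - d * (4 * L)))%N.
Proof.
rewrite r2E subnK; first by rewrite mulnC leq_divM.
rewrite -(ler_nat R); have [h1 _] := M1_bounds.
have := @divn_ge (u * (u - d * (4 * L))) 2 isT; have := u_sqr; have := two_plus_le.
have := deltaxl_ge; rewrite -muln2 [(M1 * 2)%:R]natrM; move: (_ %/ _)%:R => z; lra.
Qed.

Lemma u_gt0 : (0 < u)%N.
Proof.
rewrite -(ltr_nat R); have [_ ub] := u_bounds; have := x_ge; have := a_ge64; nra.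
Qed.

Lemma d_lt_n : (d < n)%N.
Proof.
rewrite -(ltr_nat R) DE xE; have := D_ge2; have := aa_ge1; have := n_large0.
move: (a * a) => z; nra.
Qed.

Lemma d_le_A : (d <= A)%N.
Proof.
rewrite -(ler_nat R) DE aE; have := D_ge2; have /andP[d0 d1] := delta01.
have : delta * a <= a by rewrite ler_piMl // -aE ler0n.
have := A_large; nra.
Qed.

Lemma du_le_n : (d * u <= n)%N.
Proof.
by apply: leq_trans (leq_divM n A); rewrite uE mulnC leq_mul2l d_le_A orbT.
Qed.

Lemma double_N : (2 * N = n * (n - 1))%N.
Proof. by rewrite NE; case: (n) => [|m] //; rewrite -mul_bin_diag bin1 subn1. Qed.

Lemma n_ge : (200 <= n)%N.
Proof. by rewrite -(ler_nat R) xE; have := x_ge; have := aa_ge1; lra. Qed.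

Lemma n_le_N : (8 * n <= N)%N.
Proof.
rewrite -(leq_pmul2l (isT : 0 < 2)%N) double_N mulnA mulnC leq_mul2l; apply/orP; right.
by rewrite leq_subRL; apply: leq_trans n_ge.
Qed.

Lemma u_le_n : (u <= n)%N. Proof. by rewrite uE leq_div. Qed.

Lemma r1_le_N : (r1 <= N)%N.
Proof.
have h : (q * (q - 1) <= n * (n - 1))%N.
  have qn : (q <= n)%N by by apply: leq_trans u_le_n; rewrite qE leq_div.
  by apply: leq_mul => //; apply: leq_sub2r.
by rewrite -double_N in h; apply: rate_le_of_quarter r1_M1 h.
Qed.

Lemma r2_le_N : (r2 <= N)%N.
Proof.
have h : (u * (u - d * (4 * L)) <= n * (n - 1))%N.
  apply: leq_mul; first exact: u_le_n.
  apply: leq_sub; first exact: u_le_n.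
  by rewrite !muln_gt0 /= L_gt0 andbT; apply: leq_trans d2.
by rewrite -double_N in h; apply: rate_le_of_half r2_M2 h.
Qed.

Lemma r3_le_N : (r3 <= N)%N.
Proof.
apply: leq_trans n_le_N; rewrite r3E -!subnDA.
by apply: leq_trans (leq_subr _ _) _; exact: leq_pmull.
Qed.

Lemma r4_le_N : (r4 <= N)%N.
Proof.
apply: leq_trans n_le_N; apply: (@leq_trans (8 * (u * A))).
  rewrite r4E LE -mulnA leq_mul2l /= mulnC leq_mul2r; apply/orP; right.
  by apply: leq_trans (leq_subr _ _) _; rewrite -divn2 leq_div.
by rewrite leq_mul2l uE leq_divM orbT.
Qed.

Lemma a_delta : 16 * (D + 2) <= delta * a.
Proof. by have := A_large; have := D_ge2; nra. Qed.

Lemma r3_ge : (1 - delta / 16) * x <= r3%:R.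
Proof.
rewrite r3E; have := natrB_lower (n - (d * u + u) - d * L.*2) k.
have := natrB_lower (n - (d * u + u)) (d * L.*2); have := natrB_lower n (d * u + u).
have -> : (d * L.*2)%:R = 16 * D * a by rewrite LE -muln2 !natrM DE aE; lra.
rewrite natrD natrM DE xE => s1 s2 s3.
have [ub _] := u_bounds; have [kb _] := k_bounds; have Dg := D_ge2.
have ad := a_delta; have ag := a_ge64; have x0 := x_gt0.
have a0 : 0 < a by lra.
have h1 : (D + 2) * (x / a) <= delta / 16 * x.
  by rewrite mulrA ler_pdivrMr // mulrAC; apply: ler_wpM2r; [exact: ltW | lra].
have h2 : u%:R <= x / a by rewrite ler_pdivlMr.
(* In units of [x / a], poor vertices cost [D + 1], [k] a quarter and shunned vertices at most three
   quarters, in total the [D + 2] of [h1]. *)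
have h3 : 64 * D * a <= x / a * 3.
  have x3 : 64 * D * a * a <= x * 3 by move: n_large0 x0; lra.
  by rewrite [leRHS]mulrAC ler_pdivlMr.
have : (D + 1) * u%:R <= (D + 1) * (x / a) by apply: ler_wpM2l => //; lra.
move: (x / a) h1 h2 h3 => z h1 h2 h3; lra.
Qed.

(** With [L = 8 A] and [k] about [u / 4], [L * (u / 2 - k)] is about [2 A u], hence about [2 n]: the
    8 gives twice what is needed. *)
Lemma r4_ge : (1 - delta / 16) * x <= r4%:R.
Proof.
rewrite r4E natrM; have -> : L%:R = 8 * a by rewrite LE natrM aE.
have [kb _] := k_bounds; have [_ ub] := u_bounds; have := natrB_lower u./2 k.
have : u%:R <= 2 * (u./2)%:R + 1 :> R.
  by rewrite -natrM natr1 ler_nat -{1}(odd_double_half u) mul2n; case: odd.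
move: (u./2)%:R (u./2 - k)%:R => v w vb wb.
have /andP[d0 d1] := delta01; have xg := x_ge; have ag := a_ge64.
have h : 2 * u%:R - 4 <= 8 * w by lra.
have : (2 * u%:R - 4) * a <= 8 * w * a by apply: ler_wpM2r => //; lra.
nra.
Qed.

Lemma budget :
  ((d * n + (d + 2) * (d * u + u) + (2 * d + 4) * (n %/ L) + d * u)%:R <= 2 * b)%R.
Proof.
have [ub _] := u_bounds; have Dg := D_ge2; have ag := a_ge64; have x0 := x_gt0.
have a0 : 0 < a by lra.
have h2 : u%:R <= x / a by rewrite ler_pdivlMr.
have h3 : (n %/ L)%:R <= x / a.
  by apply: le_trans h2; rewrite ler_nat uE leq_div2l ?A_gt0 // LE leq_pmull.
have h1 : ((D + 2) * (D + 1) + 3 * D + 4) * (x / a) <= delta * x.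
  rewrite mulrA ler_pdivrMr // mulrAC; apply: ler_wpM2r; first exact: ltW.
  by have := A_large; lra.
rewrite !natrD !natrM !natrD !natrM DE xE bE.
have p1 : (D + 2) * (D + 1) * u%:R <= (D + 2) * (D + 1) * (x / a).
  by apply: ler_wpM2l => //; nra.
have p2 : (2 * D + 4) * (n %/ L)%:R <= (2 * D + 4) * (x / a).
  by apply: ler_wpM2l => //; lra.
have p3 : D * u%:R <= D * (x / a) by apply: ler_wpM2l => //; lra.
have p4 : delta * x <= delta * (D * x).
  have /andP[d0 _] := delta01; apply: ler_wpM2l; first exact: ltW.
  by rewrite ler_peMl; lra.
move: (x / a) h1 p1 p2 p3 => z h1 p1 p2 p3; lra.
Qed.

Lemma B_ge1 : 1 <= B.
Proof. by have /andP[d0 d1] := delta01; rewrite BE ler_pdivlMr //; lra. Qed.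

Lemma N_gt0 : 0 < N%:R :> R.
Proof. by rewrite ltr0n; apply: leq_ltn_trans t_lt_N. Qed.

Lemma N_le : N%:R <= x * x / 2.
Proof. by rewrite N_eq; have := x_gt0; lra. Qed.

Lemma exp2_le (m : nat) : 2 ^+ m <= expR m%:R :> R.
Proof.
rewrite -[m%:R]mulr1 expRM_natl; apply: lerXn2r; rewrite ?nnegrE ?expR_ge0 //.
by apply: le_trans (expR_ge1Dx _); lra.
Qed.

Lemma early_bound (r K : nat) : (r <= N)%N -> (K <= d * n)%N -> c * (x * x) <= r%:R ->
  2 ^+ K * (1 - r%:R / N%:R * (1 - 2^-1)) ^+ M1 <= tau.
Proof.
move=> rN Kn rc; have /andP[d0 d1] := delta01; have x0 := x_gt0.
have y : (D + 1) * x <= r%:R / N%:R * (1 - 2^-1) * M1%:R.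
  apply: (early_phase_rate x0 _ d0 N_gt0 N_le c_gt0 rc M1_bounds.2).
    by have := D_ge2; lra.
  by rewrite -mulrA; exact: n_large2.
have two1 : 1 <= 2 :> R by lra.
have h := hitting_time_bound rN two1 y.
apply: (@le_trans _ _ (expR (D * x) * expR (- ((D + 1) * x)))).
  apply: ler_pM; [by apply: exprn_ge0 | | | exact: h].
    have rN1 : r%:R / N%:R <= 1 :> R by rewrite ler_pdivrMr ?N_gt0 // mul1r ler_nat.
    by apply: exprn_ge0; lra.
  by apply: le_trans (exp2_le K) _; rewrite ler_expR -DE -xE -natrM ler_nat.
rewrite -expRD tauE ler_expR.
have := l_le; have := l_ge96; nra.
Qed.

Lemma final_bound (r : nat) : (r <= N)%N -> (1 - delta / 16) * x <= r%:R ->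
  x * (1 - r%:R / N%:R * (1 - B^-1)) ^+ (t - M1.*2) <= tau.
Proof.
move=> rN rx; have l0 : 0 <= l by have := l_ge96; lra.
have m_ge : (1 + delta / 2) * (x * l / 2) <= (t - M1.*2)%:R.
  by rewrite natrB ?M2_le_t // phase3_length.
have y := final_phase_rate delta01 x_gt0 l0 N_gt0 N_le rx m_ge; rewrite -BE in y.
have := hitting_time_bound rN B_ge1 y => h.
apply: (@le_trans _ _ (x * expR (- ((1 + delta / 4) * l)))).
  by apply: ler_wpM2l => //; exact/ltW/x_gt0.
by rewrite -{1}lE -expRD tauE ler_expR; lra.
Qed.

Lemma k_ge : 12 * l <= k%:R.
Proof.
have [_ kb] := k_bounds; have [_ ub] := u_bounds; have xg := x_ge; have ag := a_ge64.
have h : x <= 8 * a * k%:R by nra.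
have p : 96 * a * c <= 1.
  rewrite -[leRHS]cE; apply: ler_wpM2r; first exact/ltW/c_gt0.
  have : a <= a * a by rewrite ler_peMl; lra.
  have : a * a <= a * a * (a * a) by rewrite ler_peMl; have := aa_ge1; lra.
  have := ag; lra.
have : 96 * a * l <= 8 * a * k%:R.
  apply: le_trans h; have : 96 * a * l <= 96 * a * (c * x).
    by apply: ler_wpM2l; [lra | exact: n_large1].
  have : 96 * a * c * x <= 1 * x by apply: ler_wpM2r p; exact/ltW/x_gt0.
  lra.
have -> : 96 * a * l = 8 * a * (12 * l) by lra.
by rewrite ler_pM2l //; lra.
Qed.

(** The union bound contributes [l] to the exponent, the moment [4 l], and [2 ^ k >= expR (k / 2)]
    at least [- 6 l] is subtracted because [k >= 12 l]. The total [- l] is below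
    [- delta / 4 * l]. *)
Lemma degree_tail : x * ((1 + x / (N - t)%:R) ^+ t / 2 ^+ k) <= tau.
Proof.
have Nt0 : 0 < (N - t)%:R :> R by rewrite ltr0n subn_gt0 t_lt_N.
have NtE : (N - t)%:R = N%:R - t%:R :> R by rewrite natrB // ltnW // t_lt_N.
have x0 := x_gt0; have l1 := l_ge96.
have h1 : (1 + x / (N - t)%:R) ^+ t <= expR (4 * l).
  apply: le_trans (one_add_exp _ _) _; first by rewrite divr_ge0 // ltW.
  rewrite ler_expR mulrAC ler_pdivrMr // NtE.
  have := N_sub_t; have := t_le; move: (N%:R - t%:R) => w tl wx.
  have : x * t%:R <= x * (x * l) by rewrite ler_wpM2l // ltW.
  have : 4 * l * (x * x / 4) <= 4 * l * w by rewrite ler_wpM2l //; lra.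
  lra.
have h2 : (2 ^+ k)^-1 <= expR (- (6 * l)).
  rewrite -exprVn; apply: (@le_trans _ _ (expR (- 2^-1) ^+ k)).
    apply: lerXn2r; rewrite ?nnegrE ?expR_ge0 ?invr_ge0 //.
    by apply: le_trans (expR_ge1Dx _); lra.
  by rewrite -expRM_natl ler_expR; have := k_ge; lra.
apply: (@le_trans _ _ (expR l * (expR (4 * l) * expR (- (6 * l))))).
  rewrite lE; apply: ler_wpM2l; first exact: ltW.
  apply: ler_pM; [ | by rewrite invr_ge0 exprn_ge0 | exact: h1 | exact: h2].
  by apply: exprn_ge0; rewrite addr_ge0 // divr_ge0 // ltW.
rewrite -!expRD tauE ler_expR; have /andP[d0 d1] := delta01.
have : delta / 4 * l <= l by rewrite ler_piMl //; lra.
lra.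
Qed.

Lemma fixed_delta_strategy : exists2 f : strategy n,
  forall p s, #|graph_at f p s|%:R <= b &
  #|[set p : ordering n | ~~ d_connected (graph_at f p t) d]%SET|%:R <=
    #|{: ordering n}|%:R * ((B ^+ d + D + 3) * tau).
Proof.
have /andP[d0 d1] := delta01; have x0 := x_gt0.
exists (capped n d u L M1 M1.*2 b).
  move=> p s; apply: graph_at_le; rewrite bE; apply: mulr_ge0; first lra.
  by have := D_ge2; nra.
have M12 : (M1 <= M1.*2)%N by rewrite -addnn leq_addr.
have b1 := early_bound r1_le_N (leq_pmull n (ltnW d2)) r1_ge.
have b2 := early_bound r2_le_N (leqnn _) r2_ge.
have b3 := final_bound r3_le_N r3_ge; have b4 := final_bound r4_le_N r4_ge.
have b5 := degree_tail.
have [h1 h2 h3 h4 h5] := And5 t_lt_N r1_le_N r2_le_N r3_le_N r4_le_N.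
have h6 := r1_M1; rewrite qE in h6; rewrite r3E in b3 h4; rewrite r4E in b4 h5.
rewrite NE in b1 b2 b3 b4 b5 h1 h2 h3 h4 h5.
have F := failure_bound u_gt0 L_gt0 M12 d2 d_lt_n du_le_n M2_le_t h1 B_ge1
  h2 h6 h3 r2_M2 h4 h5 budget.
apply: (le_trans F).
apply: ler_wpM2l; first exact: ler0n.
have -> : (M1.*2 - M1 = M1)%N by rewrite -addnn addnK.
rewrite xE DE.
have -> : (B ^+ d + D + 3) * tau = tau + tau + B ^+ d * tau + D * tau + tau by lra.
do !apply: lerD => //.
  rewrite mulrCA; apply: ler_wpM2l b3; rewrite exprn_ge0 //.
  by have := B_ge1; lra.
rewrite expr0 mul1r mulrAC mulrC; apply: ler_wpM2l b4.
by have := D_ge2; lra.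
Qed.

End ParameterChoice.

(** * Letting [delta] tend to 0 *)

Section Diagonal.
Variables (R : realType) (d : nat).
Hypothesis d2 : (2 <= d)%N.

Definition within_budget (n : nat) (delta : R) (f : strategy n) : Prop :=
  forall p s, #|graph_at f p s|%:R <= (1 + delta) * (d%:R * n%:R / 2).

Definition failures (n : nat) (delta : R) (f : strategy n) : {set ordering n} :=
  [set p : ordering n | ~~ d_connected
     (graph_at f p (Num.truncn ((1 + delta) * (n%:R * ln n%:R / 2)))) d]%SET.

Lemma strategy_of_ln_large (delta : R) : 0 < delta <= 1 ->
  exists C K : R, 0 <= C /\ forall n, (0 < n)%N -> K <= ln (n%:R : R) ->
    exists2 f : strategy n, within_budget delta f &
      #|failures delta f|%:R <= #|{: ordering n}|%:R * (C * expR (- (delta / 4 * ln n%:R))).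
Proof.
move=> delta01; have /andP[de0 de1] := delta01.
pose D : R := d%:R; have D2 : 2 <= D by rewrite /D ler_nat.
(* The first summand keeps the loss in the final rate below [delta / 16]; the others are the
   coefficients of [n / A] in the edge budget. *)
pose S : R := 16 * (D + 2) + (D + 2) * (D + 1) + 3 * D + 4.
pose A := (Num.truncn (S / delta)).+1; pose a : R := A%:R.
have S0 : 0 <= S by rewrite /S; nra.
have SA : S <= delta * a.
  rewrite mulrC -ler_pdivrMr //; apply/ltW.
  by have /andP[_] := truncn_itv (divr_ge0 S0 (ltW de0)).
have a1 : 1 <= a by rewrite /a ler1n.
have a4 : 0 < a * a * (a * a) by rewrite !mulr_gt0 //; lra.
have aaaa0 : 0 < 2048 * (a * a * (a * a)) by apply: mulr_gt0 a4; rewrite ltr0n.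
pose c := (2048 * (a * a * (a * a)))^-1.
have c0 : 0 < c by rewrite invr_gt0 aaaa0.
have cE := mulfV (lt0r_neq0 aaaa0); rewrite -/c in cE.
(* [K1] gives [l <= c * x] through [x >= l ^ 2 / 4], and [K2] makes the early phases long enough.
   The remaining term of the threshold uses [x >= 1 + l]. *)
pose K1 := 4 / c; pose K2 := 32 * (D + 1) / (c * delta).
have K10 : 0 < K1 by rewrite divr_gt0.
have K20 : 0 < K2 by rewrite divr_gt0 ?mulr_gt0 //; lra.
have K30 : 0 <= 100 * D * (a * a) by rewrite !mulr_ge0 //; lra.
exists ((16 / delta) ^+ d + D + 3), (K1 + K2 + 100 * D * (a * a)); split.
  by have : 0 <= (16 / delta) ^+ d by [rewrite exprn_ge0 // divr_ge0 // ltW]; lra.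
move=> n n0; set l := ln _ => Kl.
have lE : expR l = n%:R by rewrite lnK // posrE ltr0n.
have l1 : K1 <= l by lra.
have l0 : 0 <= l by lra.
have F := fixed_delta_strategy (erefl D) (erefl a) (erefl (n%:R : R)) lE
  (erefl _) (erefl _) (erefl _) (erefl _) (erefl _) (erefl _) (erefl _)
  (erefl _) (erefl _) (erefl _) (erefl _) cE (erefl _) (erefl _) (erefl _) d2 delta01 SA.
apply: F.
- by rewrite -lE; apply: le_trans (expR_ge1Dx _); lra.
- rewrite -lE; have h := ge_expR_sqr l0.
  have cl : 4 <= c * l by rewrite mulrC -ler_pdivrMr.
  have : c * (l * l / 4) <= c * expR l by rewrite ler_wpM2l // ltW.
  have : 4 * l <= c * l * l by rewrite ler_wpM2r.
  lra.
- have : K2 <= l by lra.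
  by rewrite /K2 ler_pdivrMr ?mulr_gt0 // [leRHS]mulrC -mulrA.
Qed.

Lemma strategy_eventually (delta eta : R) : 0 < delta <= 1 -> 0 < eta ->
  exists N : nat, forall n, (N <= n)%N -> exists2 f : strategy n, within_budget delta f &
    #|failures delta f|%:R <= #|{: ordering n}|%:R * eta.
Proof.
move=> delta01 eta0; have /andP[de0 de1] := delta01.
have [C [K [C0 H]]] := strategy_of_ln_large delta01.
pose K' := `|K| + 4 * C / (delta * eta).
have K'0 : 0 <= 4 * C / (delta * eta) by rewrite divr_ge0 ?mulr_ge0 // ltW ?mulr_gt0.
exists (Num.truncn (expR K')).+1 => n Nn.
have xK : expR K' <= n%:R.
  apply: le_trans (_ : (Num.truncn (expR K')).+1%:R <= _); last by rewrite ler_nat.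
  by have /andP[_ /ltW] := truncn_itv (expR_ge0 K').
have n0 : (0 < n)%N by apply: leq_trans Nn.
have lK : K' <= ln (n%:R : R) by rewrite -ler_expR lnK // posrE ltr0n.
have KK' : K <= K' by rewrite /K'; have := ler_norm K; lra.
have [f fb ff] := H n n0 (le_trans KK' lK); exists f => //.
apply: le_trans ff _; apply: ler_wpM2l; first exact: ler0n.
set y := delta / 4 * _; have y0 : C / eta <= y.
  have : 4 * C / (delta * eta) <= ln (n%:R : R).
    by apply: le_trans lK; rewrite /K'; have := normr_ge0 K; lra.
  have -> : C / eta = delta / 4 * (4 * C / (delta * eta)).
    by field; rewrite !gt_eqF.
  by move=> h; rewrite /y ler_wpM2l //; lra.
rewrite expRN ler_pdivrMr ?expR_gt0 // mulrC -ler_pdivrMr //.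
by apply: le_trans (expR_ge1Dx _); lra.
Qed.

(** For each [n] the largest [k <= n] with [N k <= n] is taken; the bound [k <= n] guarantees that a
    largest one exists. If there is none, rejecting every edge respects the budget, with [k = 0] as
    default. *)
Lemma strategy_diagonal (N : nat -> nat) :
    (forall k n, (N k <= n)%N -> exists2 f : strategy n, within_budget k.+1%:R^-1 f &
      #|failures k.+1%:R^-1 f|%:R <= #|{: ordering n}|%:R * (k.+1%:R^-1 : R)) ->
  forall n, exists kf : nat * strategy n, within_budget kf.1.+1%:R^-1 kf.2 /\
    forall k, (k <= n)%N -> (N k <= n)%N -> (k <= kf.1)%N /\
      #|failures kf.1.+1%:R^-1 kf.2|%:R <= #|{: ordering n}|%:R * (kf.1.+1%:R^-1 : R).
Proof.
move=> H n; have [ex|nex] := pselect (exists k, (k <= n)%N && (N k <= n)%N).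
  have le k : (k <= n)%N && (N k <= n)%N -> (k <= n)%N by case/andP.
  case: (ex_maxnP ex le) => k /andP[kn Nk] kmax.
  have [f fb ff] := H k n Nk; exists (k, f); split => // j jn Nj.
  by split => //; apply: kmax; rewrite jn.
exists (0%N, [ffun=> false]); split => [p s|k kn Nk]; last first.
  by case: nex; exists k; rewrite kn.
have -> : graph_at [ffun=> false] p s = finset.set0.
  by apply/finset.setP => X; rewrite !inE; apply/imsetP => -[i]; rewrite !inE ffunE andbF.
by rewrite cards0 mulr_ge0 ?addr_ge0 ?divr_ge0 ?mulr_ge0 ?invr_ge0.
Qed.

Section PointMass.
Variables (n : nat) (f0 : strategy n).

Lemma point_mass_ge0 (f : strategy n) : 0 <= (f == f0)%:R :> R.
Proof. exact: ler0n. Qed.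

Lemma point_mass_sum1 : \sum_(f : strategy n) (f == f0)%:R = 1 :> R.
Proof. by rewrite (bigD1 f0) //= eqxx big1 ?addr0 // => f /negPf ->. Qed.

Definition point_mass : random_strategy R n :=
  RandomStrategy point_mass_ge0 point_mass_sum1.

Lemma prob_point_mass (E : strategy n -> ordering n -> bool) :
  prob point_mass E = #|[set p : ordering n | E f0 p]%SET|%:R / #|{: ordering n}|%:R.
Proof.
rewrite /prob (bigD1 f0) //= eqxx mul1r big1 ?addr0 // => f /negPf ->.
by rewrite mul0r.
Qed.

Lemma card_ordering_gt0 : 0 < #|{: ordering n}|%:R :> R.
Proof. by rewrite ltr0n card_ordering fact_gt0. Qed.

Lemma prob_point_mass_ge (delta eta : R) :
    #|failures delta f0|%:R <= #|{: ordering n}|%:R * eta ->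
  `|1 - prob point_mass (fun f p => d_connected
     (graph_at f p (Num.truncn ((1 + delta) * (n%:R * ln n%:R / 2)))) d)| <= eta.
Proof.
move=> fail; have N0 := card_ordering_gt0; rewrite prob_point_mass.
set G := [set p | _]%SET.
have failE : #|failures delta f0|%:R = #|{: ordering n}|%:R - #|G|%:R :> R.
  rewrite -(cardsC G) natrD addrC addKr; congr (_%:R); apply: eq_card => p.
  by rewrite !inE.
have -> : 1 - #|G|%:R / #|{: ordering n}|%:R = #|failures delta f0|%:R / #|{: ordering n}|%:R :> R.
  by rewrite failE mulrBl divff ?gt_eqF.
by rewrite ger0_norm ?divr_ge0 // ler_pdivrMr // mulrC.
Qed.

End PointMass.

End Diagonal.

Local Open Scope classical_set_scope.

Theorem theorem1p2 (R : realType) (d : nat) (hd : (2 <= d)%N) :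
  exists eps : nat -> R,
    eps @ \oo --> (0 : R) /\
    let t := fun n : nat => (1 + eps n) * (n%:R * ln n%:R / 2) in
    let b := fun n : nat => (1 + eps n) * (d%:R * n%:R / 2) in
    exists B : forall n : nat, random_strategy R n,
      (forall n : nat, (1 <= n)%N -> tb_strategy (t n) (b n) (B n)) /\
      (fun n : nat =>
         prob (B n) (fun f p => d_connected (graph_at f p (Num.truncn (t n))) d))
        @ \oo --> (1 : R).
Proof.
have inv01 k : 0 < (k.+1%:R^-1 : R) <= 1.
  by rewrite invr_gt0 ltr0n /= invf_le1 ?ltr0n // ler1n.
have inv0 k : 0 < (k.+1%:R^-1 : R) by have /andP[] := inv01 k.
have [N NP] := choice (fun k => strategy_eventually hd (inv01 k) (inv0 k)).
have kfP n := cid (strategy_diagonal NP n).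
pose kf n := projT1 (kfP n).
have kf_budget n : within_budget d (kf n).1.+1%:R^-1 (kf n).2 := (projT2 (kfP n)).1.
have kf_large n := (projT2 (kfP n)).2.
pose eps n : R := (kf n).1.+1%:R^-1.
(* The [k]-th strategy was chosen with both its [delta] and its failure probability bounded by
   [1 / (k + 1)], so one threshold yields both limits. *)
have near_small (e : R) : 0 < e -> exists K, forall n, (K <= n)%N ->
    eps n <= e /\ #|failures d (eps n) (kf n).2|%:R <= #|{: ordering n}|%:R * e.
  move=> e0; pose k := Num.truncn e^-1; exists (maxn k (N k)) => n.
  rewrite geq_max => /andP[kn Nk]; have [kk fk] := kf_large n k kn Nk.
  have epse : eps n <= e.
    rewrite -[leRHS]invrK lef_pV2 ?posrE ?invr_gt0 ?ltr0n //.
    have ie0 : 0 <= e^-1 by rewrite invr_ge0 ltW.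
    have /andP[_ /ltW /le_trans] := truncn_itv ie0; apply.
    by rewrite ler_nat ltnS.
  by split => //; apply: le_trans fk _; apply: ler_wpM2l epse.
exists eps; split.
  apply/cvgrPdist_le => e /near_small[K HK]; exists K => // n /= /HK[+ _].
  by rewrite sub0r normrN ger0_norm // ltW // inv0.
move=> t b; exists (fun n => point_mass R (kf n).2); split.
  move=> n n1 f; rewrite /= ltr0n lt0b => /eqP -> p s _; exact: kf_budget.
apply/cvgrPdist_le => e /near_small[K HK]; exists K => // n /= /HK[_ +].
exact: prob_point_mass_ge.
Qed.
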